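(* Let $n,d\ge1$ be integers, $\beta\ge2$, $\alpha>0$, $L,\bar L>0$, $\sigma\ge0$, $G,\mathcal K>0$, and let $T\ge 2d$ be an integer such that $T_0=T/(2d)$ is an integer. Let $\Theta\subset\mathbb R^d$ be a nonempty convex compact set with $\mathrm{diam}(\Theta)\le\mathcal K$. Let $f_1,\dots,f_n:\mathbb R^d\to\mathbb R$ belong to $\mathcal F_\beta(L)$ and be 2-smooth with constant $\bar L$. Suppose that the average objective $f=\frac1n\sum_{i=1}^nf_i$ is $\alpha$-strongly convex and satisfies $\max_{x\in\Theta}\|\nabla f(x)\|\le G$. Let $W\in\mathbb R^{n\times n}$ be symmetric and doubly stochastic with $\rho:=\|W-n^{-1}\mathbb 1\mathbb 1^\top\|_*<1$. Let $x^i(t)$ be the iterates of the distributed zero-order gradient algorithm (defined in the context) with the $2d$-query kernel gradient estimators, with a kernel $K$ and noise satisfying the conditions given in the context, and with $\eta_t=\frac2{\alpha t}$, $h_t=t^{-\frac1{2\beta}}$. Let $\bar x(t)=\frac1n\sum_{i=1}^nx^i(t)$, $\hat x(T_0)=\frac1{T_0}\sum_{t=1}^{T_0}\bar x(t)$, and let $x^*$ be the minimizer of $f$ over $\Theta$. Then $$\mathbb E[f(\hat x(T/(2d)))-f(x^* )]\le\mathcal C\min\left\{1,\frac{d^{2-1/\beta}}{\alpha(1-\rho)}T^{-\frac{\beta-1}\beta}\right\},$$ where $\mathcal C>0$ is a positive constant independent of $T,d,\alpha,n,\rho$.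
   Context: Notation. $\|\cdot\|$ is the Euclidean norm, $\|\cdot\|_*$ the spectral norm of a matrix, $\mathbb 1\in\mathbb R^n$ the all-ones vector, $e_j$ the $j$-th canonical basis vector of $\mathbb R^d$, $\mathrm{Proj}_\Theta$ the Euclidean projection onto $\Theta$, $\mathrm{diam}$ the Euclidean diameter, $U[-1,1]$ the uniform distribution on $[-1,1]$. $\lfloor x\rfloor$ denotes the maximal integer less than $x$, and $\ell=\lfloor\beta\rfloor$. Function classes. $\mathcal F_\beta(L)$ is the set of functions $F:\mathbb R^d\to\mathbb R$ that are $\ell$ times differentiable and satisfy $\big|F(z)-\sum_{0\le|m|\le\ell}\frac1{m!}D^mF(x)(z-x)^m\big|\le L\|z-x\|^\beta$ for all $x,z\in\mathbb R^d$ (sum over multi-indices $m\in\mathbb N^d$, usual multi-index notation). $F$ is 2-smooth with constant $\bar L$ if it is differentiable on $\mathbb R^d$ and $\|\nabla F(x)-\nabla F(x')\|\le\bar L\|x-x'\|$ for all $x,x'\in\mathbb R^d$. $F$ is $\alpha$-strongly convex if it is differentiable on $\mathbb R^d$ and $F(x)-F(x')\ge\langle\nabla F(x'),x-x'\rangle+\frac\alpha2\|x-x'\|^2$ for all $x,x'\in\mathbb R^d$. Kernel. $K:[-1,1]\to\mathbb R$ satisfies (integrals over $[-1,1]$): $\int uK(u)\,du=1$, $\int u^jK(u)\,du=0$ for $j=0,2,3,\dots,\ell$, $\kappa_\beta:=\int|u|^\beta|K(u)|\,du<\infty$, and $\kappa:=\int K^2(u)\,du<\infty$. Algorithm. Choose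 initial vectors $x^1(1)=\dots=x^n(1)\in\mathbb R^d$. At each step $t=1,2,\dots$, each agent $i$ draws $r_i(t)\sim U[-1,1]$, observes for $j=1,\dots,d$ the values $y_{i,j}(t)=f_i(x^i(t)+h_tr_i(t)e_j)+\xi_{i,j}(t)$ and $y'_{i,j}(t)=f_i(x^i(t)-h_tr_i(t)e_j)+\xi'_{i,j}(t)$, and forms $g^i(t)\in\mathbb R^d$ with $j$-th coordinate $\frac1{2h_t}(y_{i,j}(t)-y'_{i,j}(t))K(r_i(t))$. Then $x^i(t+1)=\sum_{k=1}^nW_{ik}\,\mathrm{Proj}_\Theta\big(x^k(t)-\eta_tg^k(t)\big)$, $i=1,\dots,n$. Each step uses $2d$ queries of each $f_i$, so $T_0=T/(2d)$ steps correspond to a total budget of $T$ queries. Noise assumption. Let $\mathcal F_t$ be the $\sigma$-algebra generated by $x^1(t),\dots,x^n(t)$. For all integers $t$ and all $i\in\{1,\dots,n\}$: (i) $r_i(t)\sim U[-1,1]$ is independent of $\xi_{i,1}(t),\dots,\xi_{i,d}(t),\xi'_{i,1}(t),\dots,\xi'_{i,d}(t)$ and of $\mathcal F_t$; (ii) $\mathbb E[(\xi_{i,j}(t))^2]\le\sigma^2$ and $\mathbb E[(\xi'_{i,j}(t))^2]\le\sigma^2$ for $j=1,\dots,d$. The noises need not have zero mean nor be independent of each other.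
   Formalization: The constant C is allowed to depend also on the maximum over i and over Θ of ‖∇f_i‖ and on the distance from the initial vector x^1(1) to Θ; without this the bound fails, since x^1(1) is arbitrary in R^d and only the average gradient is bounded by G. *)

(* Defs.v *)
From HB Require Import structures.
From mathcomp Require Import all_boot all_order all_algebra.
From mathcomp Require Import all_classical all_reals all_analysis.

Set Implicit Arguments.
Unset Strict Implicit.
Unset Printing Implicit Defensive.

Import Order.TTheory GRing.Theory Num.Theory.
Import numFieldNormedType.Exports.

Local Open Scope classical_set_scope.
Local Open Scope ring_scope.

Section euclidean.
Context {R : realType}.

(* The norm [`|v|] of the library on matrices is the sup norm. *)
Definition enorm d (v : 'rV[R]_d) : R := Num.sqrt (\sum_(j < d) v 0 j ^+ 2).

Definition edot d (u v : 'rV[R]_d) : R := \sum_(j < d) u 0 j * v 0 j.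

Definition ediam d (A : set 'rV[R]_d) : R :=
  sup [set s | exists x y, [/\ A x, A y & s = enorm (x - y)]].

Definition edist_set d (x : 'rV[R]_d) (A : set 'rV[R]_d) : R :=
  inf [set enorm (x - y) | y in A].

(* The unique nearest point when [A] is nonempty, closed and convex. *)
Definition eproj d (A : set 'rV[R]_d) (x : 'rV[R]_d) : 'rV[R]_d :=
  get [set p | A p /\ forall q, A q -> enorm (x - p) <= enorm (x - q)].

(* Operator norm induced by [enorm]; [v *m A^T] is the transpose of [A v]. *)
Definition spectral_norm m n (A : 'M[R]_(m, n)) : R :=
  sup [set enorm (v *m A^T) | v in [set v : 'rV[R]_n | enorm v <= 1]].

Definition doubly_stochastic n (W : 'M[R]_n) : Prop :=
  [/\ forall i j, 0 <= W i j,
      forall i, \sum_j W i j = 1 &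
      forall j, \sum_i W i j = 1].

End euclidean.

Section function_classes.
Context {R : realType}.

Definition partial d (j : 'I_d) (F : 'rV[R]_d -> R) : 'rV[R]_d -> R :=
  fun x => 'D_(delta_mx 0 j) F x.

Definition grad d (F : 'rV[R]_d -> R) (x : 'rV[R]_d) : 'rV[R]_d :=
  \row_j partial j F x.

(* [k] times Frechet differentiable on the whole space: since the target of
   the derivative is finite dimensional, it is [k] times differentiable iff
   its coordinates, the partial derivatives, are. *)
Fixpoint ndifferentiable d (k : nat) (F : 'rV[R]_d -> R) : Prop :=
  match k with
  | 0%N => True
  | k'.+1 => (forall x, differentiable F x) /\
             (forall j, ndifferentiable k' (partial j F))
  end.

(* Multi-indices of order at most [l] are the [m : {ffun 'I_d -> 'I_l.+1}] whose
   entries sum to at most [l]. *)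
Definition mpartial d l (m : {ffun 'I_d -> 'I_l.+1}) (F : 'rV[R]_d -> R) :
    'rV[R]_d -> R :=
  foldr (fun j H => iter (m j) (partial j) H) F (enum 'I_d).

Definition taylor d l (F : 'rV[R]_d -> R) (x z : 'rV[R]_d) : R :=
  \sum_(m : {ffun 'I_d -> 'I_l.+1} | (\sum_j m j <= l)%N)
    (\prod_j (m j)`!)%:R^-1 * mpartial m F x * \prod_j (z 0 j - x 0 j) ^+ m j.

(* The largest integer strictly less than [b]. *)
Definition strict_floor (b : R) : nat := `|Num.ceil b|%N.-1.

Lemma strict_floorP (b : R) : 0 < b ->
  (strict_floor b)%:R < b <= (strict_floor b).+1%:R.
Proof.
move=> b0; rewrite /strict_floor.
have c0 : (0 < Num.ceil b)%R by rewrite -ceil_gt0 in b0 *.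
have cE : Num.ceil b = Posz `|Num.ceil b|%N by rewrite gez0_abs// ltW.
have a0 : (0 < `|Num.ceil b|)%N by rewrite absz_gt0 gt_eqF.
have := ceil_itv b; rewrite prednK// {1 2}cE => /andP[h1 h2].
apply/andP; split; last by move: h2; rewrite -pmulrn.
move: h1; rewrite intrD mulrNz -pmulrn; congr (_ < _).
by rewrite -[in LHS](prednK a0) -addn1 natrD mulr1z addrK.
Qed.

Definition holder_class d (beta L : R) (F : 'rV[R]_d -> R) : Prop :=
  ndifferentiable (strict_floor beta) F /\
  forall x z, `|F z - taylor (strict_floor beta) F x z|
              <= L * enorm (z - x) `^ beta.

Definition smooth2 d (Lbar : R) (F : 'rV[R]_d -> R) : Prop :=
  (forall x, differentiable F x) /\
  forall x y, enorm (grad F x - grad F y) <= Lbar * enorm (x - y).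

Definition strongly_convex d (alpha : R) (F : 'rV[R]_d -> R) : Prop :=
  (forall x, differentiable F x) /\
  forall x y, F x - F y >=
    edot (grad F y) (x - y) + alpha / 2 * enorm (x - y) ^+ 2.

Definition average_fun n d (f : 'I_n -> 'rV[R]_d -> R) : 'rV[R]_d -> R :=
  fun x => n%:R^-1 * \sum_i f i x.

(* Strong convexity bounds nothing about the individual [f i], and the starting
   point need not lie in the constraint set: the constant of the rate depends on
   the former through [max_grad] and on the latter through [edist_set]. *)
Definition max_grad n d (f : 'I_n -> 'rV[R]_d -> R) (A : set 'rV[R]_d) : R :=
  sup [set s | exists i x, A x /\ s = enorm (grad (f i) x)].

End function_classes.

Section algorithm.
Context {R : realType}.

(* Only the values of [K] on [-1, 1] are used. Measurability and square
   integrability of [K] make the moment integrals absolutely convergent. *)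
Definition kernel_cond (beta : R) (K : R -> R) : Prop :=
  let mu := @lebesgue_measure R in
  let I : set R := [set` `[-1, 1]] in
  [/\ measurable_fun I K,
      (\int[mu]_(u in I) (u * K u)%:E = 1)%E,
      forall j : nat, (j <= strict_floor beta)%N -> j != 1%N ->
        (\int[mu]_(u in I) (u ^+ j * K u)%:E = 0)%E,
      (\int[mu]_(u in I) (`|u| `^ beta * `|K u|)%:E < +oo)%E &
      (\int[mu]_(u in I) (K u ^+ 2)%:E < +oo)%E].

(* [K] is extended by 0 outside [-1, 1], where [r] lies with probability 0. *)
Definition grad_estimator d (K : R -> R) (h : R) (F : 'rV[R]_d -> R)
    (x : 'rV[R]_d) (r : R) (xi xi' : 'I_d -> R) : 'rV[R]_d :=
  \row_j
    let y  := F (x + (h * r) *: delta_mx 0 j) + xi j in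
    let y' := F (x - (h * r) *: delta_mx 0 j) + xi' j in
    (2 * h)^-1 * (y - y') * (if -1 <= r <= 1 then K r else 0).

(* Time starts at 1; [x i 0] is unconstrained and unused. *)
Definition zo_iterates n d (Omega : Type) (Theta : set 'rV[R]_d)
    (W : 'M[R]_n) (f : 'I_n -> 'rV[R]_d -> R) (K : R -> R) (eta h : nat -> R)
    (r : 'I_n -> nat -> Omega -> R) (xi xi' : 'I_n -> nat -> 'I_d -> Omega -> R)
    (x1 : 'rV[R]_d) (x : 'I_n -> nat -> Omega -> 'rV[R]_d) : Prop :=
  (forall i w, x i 1%N w = x1) /\
  (forall i t w, (1 <= t)%N ->
    x i t.+1 w = \sum_k W i k *: eproj Theta (x k t w - eta t *:
      grad_estimator K (h t) (f k) (x k t w) (r k t w)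
        (fun j => xi k t j w) (fun j => xi' k t j w))).

Definition average_iterate n d (Omega : Type)
    (x : 'I_n -> nat -> Omega -> 'rV[R]_d) (t : nat) (w : Omega) : 'rV[R]_d :=
  n%:R^-1 *: \sum_i x i t w.

Definition time_average n d (Omega : Type)
    (x : 'I_n -> nat -> Omega -> 'rV[R]_d) (T0 : nat) (w : Omega) : 'rV[R]_d :=
  T0%:R^-1 *: \sum_(1 <= t < T0.+1) average_iterate x t w.

Definition sigma_generated (Omega : Type) (S : set (Omega -> R)) :
    set (set Omega) :=
  <<s [set E | exists X B, [/\ S X, measurable B & E = X @^-1` B]] >>.

Lemma ltrN11 : (-1 : R) < 1.
Proof. by rewrite (@lt_trans _ _ 0)// ltrN10. Qed.

(* The independence is that of [r i t] from the noise vector of agent [i] and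
   [F_t] taken jointly. *)
Definition noise_cond n d dO (Omega : measurableType dO)
    (P : probability Omega R) (sigma : R) (r : 'I_n -> nat -> {RV P >-> R})
    (xi xi' : 'I_n -> nat -> 'I_d -> {RV P >-> R})
    (x : 'I_n -> nat -> Omega -> 'rV[R]_d) : Prop :=
  forall (t : nat) (i : 'I_n), (1 <= t)%N ->
  [/\ forall B : set R, measurable B ->
        distribution P (r i t) B = uniform_prob ltrN11 B,
      forall (A : set Omega) (B : set R),
        sigma_generated [set X : Omega -> R |
            [\/ exists j, X = xi i t j,
                exists j, X = xi' i t j |
                exists k j, X = (fun w => x k t w 0 j)]] A ->
        measurable B ->
        (P (A `&` r i t @^-1` B) = P A * P (r i t @^-1` B))%E,
      forall j, ('E_P[fun w => (xi i t j w ^+ 2)%R] <= (sigma ^+ 2)%:E)%E &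
      forall j, ('E_P[fun w => (xi' i t j w ^+ 2)%R] <= (sigma ^+ 2)%:E)%E].

End algorithm.

(* Main.v *)
(** Comparing the agents' squared distances to [x*] before and after a step, and
    strong convexity of the average at the mean iterate, bound each optimality gap
    pathwise by a telescoping term, a consensus error, a variance term and a bias
    term. The consensus error contracts by [rho] at each step, which costs the
    factor [1 / (1 - rho)]. Given the past, [r_i(t)] is independent of the noise, so
    the noise, of whatever mean, is integrated against the kernel to zero by
    [\int K = 0]. The kernel moments kill the Taylor terms of the two-point
    difference up to a bias of order [h ^ (beta - 1)], and its squared estimate has
    order [h ^ (-2)]. Both contribute [t ^ (1 / beta - 1)] per coordinate, whose
    average over [T0 = T / (2 d)] steps is the rate; a pathwise bound on the gap
    gives the other branch of the minimum. *)
From HB Require Import structures.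
Require Import Defs.
From mathcomp Require Import all_boot all_order all_algebra.
From mathcomp Require Import all_classical all_reals all_analysis.
From mathcomp Require Import ring lra measurable_realfun.
Set Implicit Arguments.
Unset Strict Implicit.
Unset Printing Implicit Defensive.
Import Order.TTheory GRing.Theory Num.Theory.
Import numFieldNormedType.Exports.
Local Open Scope classical_set_scope.
Local Open Scope ring_scope.

(** The law of [r_i(t)] has density 1/2, while the kernel is normalized by Lebesgue measure, so the
    estimators follow half the gradient on average. Halving the strong convexity inequality leaves
    [alpha / 4] times the mean squared distance, exactly what the telescoping with
    [eta_t = 2 / (alpha t)] consumes, and nothing to absorb the bias. The missing [alpha / 8] is
    paid by a quarter of the gap itself, through strong convexity at the minimizer; hence the gap
    enters a step with factor 1/4. At time 1 the mean may lie outside [Theta] and the gap may be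
    negative, which a term of order [1 / (alpha t)] repairs because [alpha <= Lbar]. The pathwise
    part treats arbitrary vectors [g]; probability enters through a dominating variable made of
    squared estimator coordinates and one bias expression per coordinate. Conditioning on the past
    is replaced by Fubini for two laws: that of the identity map into [Omega] with the sigma-algebra
    of past and noise, and that of [r_i(t)]. The inner integral freezes the outcome, so the noise is
    a constant there. *)

(** * Euclidean geometry of finite sums and of row vectors *)

Section sum_of_squares.
Context {R : realType} {I : finType}.
Implicit Types a b : I -> R.

Definition l2norm a : R := Num.sqrt (\sum_i a i ^+ 2).

Lemma l2norm_ge0 a : 0 <= l2norm a.
Proof. exact: sqrtr_ge0. Qed.

Lemma sqr_l2norm a : l2norm a ^+ 2 = \sum_i a i ^+ 2.
Proof. by rewrite sqr_sqrtr// sumr_ge0// => i _; exact: sqr_ge0. Qed.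

(** Sum the weighted AM-GM inequality [a b <= (s a^2 + b^2 / s) / 2] and choose [s = |b| / |a|],
    which equalizes the two terms; vanishing norms are treated apart. *)
Lemma l2norm_cauchy_schwarz a b : \sum_i a i * b i <= l2norm a * l2norm b.
Proof.
have A0 := l2norm_ge0 a; have B0 := l2norm_ge0 b.
have key s : 0 < s -> \sum_i a i * b i <=
    (s * l2norm a ^+ 2 + s^-1 * l2norm b ^+ 2) / 2.
  move=> s0; rewrite !sqr_l2norm !mulr_sumr -big_split/= mulr_suml.
  apply: ler_sum => i _; rewrite -subr_ge0.
  suff -> : (s * a i ^+ 2 + s^-1 * b i ^+ 2) / 2 - a i * b i =
      s^-1 / 2 * (s * a i - b i) ^+ 2.
    by rewrite mulr_ge0 ?sqr_ge0// divr_ge0// invr_ge0 ltW.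
  by field; lra.
have [a0|a0] := eqVneq (l2norm a) 0.
  have az i : a i = 0.
    apply/eqP; rewrite -sqrf_eq0; have := sqr_l2norm a.
    rewrite a0 expr0n/= => /esym/eqP.
    by rewrite psumr_eq0// => [/allP/(_ i)|j _]; [apply; rewrite mem_index_enum|exact: sqr_ge0].
  by rewrite a0 mul0r big1// => i _; rewrite az mul0r.
have [b0|b0] := eqVneq (l2norm b) 0.
  have bz i : b i = 0.
    apply/eqP; rewrite -sqrf_eq0; have := sqr_l2norm b.
    rewrite b0 expr0n/= => /esym/eqP.
    by rewrite psumr_eq0// => [/allP/(_ i)|j _]; [apply; rewrite mem_index_enum|exact: sqr_ge0].
  by rewrite b0 mulr0 big1// => i _; rewrite bz mulr0.
have {}A0 : 0 < l2norm a by rewrite lt_neqAle eq_sym a0.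
have {}B0 : 0 < l2norm b by rewrite lt_neqAle eq_sym b0.
have := key (l2norm b / l2norm a) (divr_gt0 B0 A0).
suff -> : (l2norm b / l2norm a * l2norm a ^+ 2 +
  (l2norm b / l2norm a)^-1 * l2norm b ^+ 2) / 2 = l2norm a * l2norm b by [].
by field; rewrite a0 b0.
Qed.

Lemma l2normD a b : l2norm (fun i => a i + b i) <= l2norm a + l2norm b.
Proof.
rewrite -(@ler_pXn2r _ 2)// ?nnegrE ?addr_ge0 ?l2norm_ge0//.
rewrite sqr_l2norm sqrrD !sqr_l2norm.
under eq_bigr do rewrite sqrrD.
rewrite !big_split/= mulr2n.
by have := l2norm_cauchy_schwarz a b; lra.
Qed.

Lemma l2normZ c a : l2norm (fun i => c * a i) = `|c| * l2norm a.
Proof.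
rewrite /l2norm; under eq_bigr do rewrite exprMn.
by rewrite -mulr_sumr sqrtrM ?sqr_ge0// sqrtr_sqr.
Qed.

Lemma l2norm_le a b : (forall i, a i ^+ 2 <= b i ^+ 2) -> l2norm a <= l2norm b.
Proof.
by move=> ab; rewrite ler_sqrt ?ler_sum// sumr_ge0// => i _; exact: sqr_ge0.
Qed.

End sum_of_squares.

Section euclidean.
Context {R : realType} {d : nat}.
Implicit Types u v w : 'rV[R]_d.

Lemma edotC u v : edot u v = edot v u.
Proof. by apply: eq_bigr => j _; rewrite mulrC. Qed.

Lemma edotDl u v w : edot (u + v) w = edot u w + edot v w.
Proof. by rewrite -big_split/=; apply: eq_bigr => j _; rewrite !mxE mulrDl. Qed.

Lemma edotZl c u v : edot (c *: u) v = c * edot u v.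
Proof. by rewrite mulr_sumr; apply: eq_bigr => j _; rewrite !mxE mulrA. Qed.

Lemma edotDr u v w : edot u (v + w) = edot u v + edot u w.
Proof. by rewrite edotC edotDl !(edotC u). Qed.

Lemma edotZr c u v : edot u (c *: v) = c * edot u v.
Proof. by rewrite edotC edotZl edotC. Qed.

Lemma edotNl u v : edot (- u) v = - edot u v.
Proof. by rewrite -scaleN1r edotZl mulN1r. Qed.

Lemma edotNr u v : edot u (- v) = - edot u v.
Proof. by rewrite edotC edotNl edotC. Qed.

Lemma edotBl u v w : edot (u - v) w = edot u w - edot v w.
Proof. by rewrite edotDl edotNl. Qed.

Lemma edotBr u v w : edot u (v - w) = edot u v - edot u w.
Proof. by rewrite edotDr edotNr. Qed.

Lemma edot0l v : edot 0 v = 0.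
Proof. by rewrite -(scale0r 0) edotZl mul0r. Qed.

Lemma edot0r v : edot v 0 = 0.
Proof. by rewrite edotC edot0l. Qed.

Lemma edot_sumr (I : Type) (s : seq I) u (v : I -> 'rV[R]_d) :
  edot u (\sum_(i <- s) v i) = \sum_(i <- s) edot u (v i).
Proof.
by apply: (big_morph (edot u)); [move=> ? ?; exact: edotDr|exact: edot0r].
Qed.

Lemma edot_suml (I : Type) (s : seq I) u (v : I -> 'rV[R]_d) :
  edot (\sum_(i <- s) v i) u = \sum_(i <- s) edot (v i) u.
Proof. by rewrite edotC edot_sumr; apply: eq_bigr => i _; rewrite edotC. Qed.

Lemma enorm_ge0 v : 0 <= enorm v.
Proof. exact: sqrtr_ge0. Qed.

Lemma sqr_enorm v : enorm v ^+ 2 = edot v v.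
Proof. by rewrite (sqr_l2norm (fun j => v 0 j)). Qed.

Lemma edot_le u v : edot u v <= enorm u * enorm v.
Proof. exact: (l2norm_cauchy_schwarz (fun j => u 0 j) (fun j => v 0 j)). Qed.

Lemma enormZ c v : enorm (c *: v) = `|c| * enorm v.
Proof.
rewrite -(l2normZ c (fun j => v 0 j)); congr Num.sqrt.
by apply: eq_bigr => j _; rewrite mxE.
Qed.

Lemma enormN v : enorm (- v) = enorm v.
Proof. by rewrite -scaleN1r enormZ normrN normr1 mul1r. Qed.

Lemma enorm_distC u v : enorm (u - v) = enorm (v - u).
Proof. by rewrite -enormN opprB. Qed.

Lemma enorm0 : enorm (0 : 'rV[R]_d) = 0.
Proof. by rewrite -(scale0r 0) enormZ normr0 mul0r. Qed.

Lemma enorm_eq0 v : enorm v = 0 -> v = 0.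
Proof.
move=> v0; apply/rowP => j; rewrite mxE; apply/eqP; rewrite -sqrf_eq0.
have /esym/eqP := sqr_enorm v; rewrite v0 expr0n/= psumr_eq0.
  by move=> /allP/(_ j); rewrite mem_index_enum -expr2; apply.
by move=> i _; rewrite -expr2 sqr_ge0.
Qed.

Lemma ler_enormD u v : enorm (u + v) <= enorm u + enorm v.
Proof.
apply: le_trans (l2normD (fun j => u 0 j) (fun j => v 0 j)).
by rewrite /enorm; under eq_bigr do rewrite mxE.
Qed.

Lemma ler_enormB u v : enorm (u - v) <= enorm u + enorm v.
Proof. by rewrite -(enormN v) ler_enormD. Qed.

Lemma sqr_enormB u v :
  enorm (u - v) ^+ 2 = enorm u ^+ 2 - 2 * edot u v + enorm v ^+ 2.
Proof. by rewrite !sqr_enorm !edotBl !edotBr (edotC v); ring. Qed.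

Lemma edot_ge u v : - (enorm u * enorm v) <= edot u v.
Proof. by rewrite lerNl -edotNl (le_trans (edot_le _ _))// enormN. Qed.

Lemma ler_enorm_sum (I : Type) (s : seq I) (v : I -> 'rV[R]_d) :
  enorm (\sum_(i <- s) v i) <= \sum_(i <- s) enorm (v i).
Proof.
elim/big_rec2 : _ => [|i x y _ xy]; first by rewrite enorm0.
by rewrite (le_trans (ler_enormD _ _))// lerD2l.
Qed.

Lemma ler_coord_enorm v j : `|v 0 j| <= enorm v.
Proof.
rewrite -[X in X <= _]sqrtr_sqr ler_sqrt.
  by rewrite (bigD1 j)//= lerDl sumr_ge0// => i _; exact: sqr_ge0.
by rewrite sumr_ge0// => i _; exact: sqr_ge0.
Qed.

Lemma enorm_delta c (j : 'I_d) : enorm (c *: delta_mx 0 j : 'rV[R]_d) = `|c|.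
Proof.
rewrite enormZ -[RHS]mulr1; congr (_ * _).
rewrite /enorm (bigD1 j)//= big1 => [|i ij].
  by rewrite mxE !eqxx/= expr1n addr0 sqrtr1.
by rewrite mxE (negbTE ij) andbF expr0n.
Qed.

(** The topology on row vectors comes from the sup norm; this comparison carries compactness and
    continuity over to Euclidean statements. *)
Lemma enorm_le_norm v : enorm v <= d%:R * `|v|.
Proof.
rewrite {1}(row_sum_delta v) (le_trans (ler_enorm_sum _ _))//.
have -> : d%:R * `|v| = \sum_(j < d) `|v| by rewrite sumr_const card_ord mulr_natl.
apply: ler_sum => j _; rewrite enorm_delta.
rewrite [leRHS]mx_normrE.
exact: (@le_bigmax _ _ _ _ (fun ij : 'I_1 * 'I_d => `|v ij.1 ij.2|) (0, j)).
Qed.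

(* Parallel-axis identity: the mean minimizes the sum of squared distances. *)
Lemma sum_sqr_enorm_mean n (z : 'I_n -> 'rV[R]_d) c :
  (0 < n)%N -> let m := n%:R^-1 *: \sum_k z k in
  \sum_k enorm (z k - c) ^+ 2 =
    \sum_k enorm (z k - m) ^+ 2 + n%:R * enorm (m - c) ^+ 2.
Proof.
move=> n0 m; have mE : \sum_k (z k - m) = 0.
  rewrite sumrB sumr_const card_ord /m -scaler_nat scalerA.
  by rewrite divff ?scale1r ?subrr// pnatr_eq0 -lt0n.
have -> : n%:R * enorm (m - c) ^+ 2 = \sum_(k < n) enorm (m - c) ^+ 2.
  by rewrite sumr_const card_ord mulr_natl.
rewrite -big_split/=; transitivity (\sum_k (enorm (z k - m) ^+ 2 +
    enorm (m - c) ^+ 2 + 2 * edot (z k - m) (m - c))).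
  apply: eq_bigr => k _; rewrite !sqr_enorm.
  have -> : z k - c = (z k - m) + (m - c) by rewrite addrA subrK.
  move: (z k - m) (m - c) => a b.
  by rewrite !edotDl !edotDr (edotC b); ring.
by rewrite big_split/= -mulr_sumr -edot_suml mE edot0l mulr0 addr0.
Qed.

End euclidean.

(** * Euclidean projection onto a compact convex set *)

Section projection.
Context {R : realType} {d : nat}.
Implicit Types (x y p q v : 'rV[R]_d) (A : set 'rV[R]_d).

Lemma enorm_lipschitz_continuous (F : 'rV[R]_d -> R) (c : R) :
  (forall x y, `|F x - F y| <= c * enorm (x - y)) -> continuous F.
Proof.
move=> Fc x; apply/(@cvgrPdist_lt _ _ _ (nbhs x)) => e e0.
(* The added ones keep [K] positive also when [c] or [d] is zero. *)
pose K := (`|c| + 1) * (d%:R + 1).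
have K0 : 0 < K by rewrite mulr_gt0// ltr_wpDl.
near=> y; apply: le_lt_trans (Fc x y) _.
apply: (@le_lt_trans _ _ (K * `|x - y|)).
  rewrite /K -mulrA (@le_trans _ _ ((`|c| + 1) * enorm (x - y)))//.
    rewrite ler_wpM2r ?enorm_ge0//.
    by rewrite (le_trans (ler_norm c))// lerDl.
  by rewrite ler_wpM2l ?addr_ge0// (le_trans (enorm_le_norm _))// ler_wpM2r// lerDl.
rewrite mulrC -ltr_pdivlMr//; near: y.
have eK : 0 < e / K by rewrite divr_gt0.
have /(@cvgrPdist_lt _ _ _ (nbhs x))/(_ _ eK) : y @[y --> x] --> x by exact: cvg_id.
exact.
Unshelve. all: by end_near. Qed.

Lemma continuous_enormB x : continuous (fun y => enorm (x - y)).
Proof.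
apply: (@enorm_lipschitz_continuous _ 1) => y z; rewrite mul1r ler_norml.
have h1 := ler_enormD (x - z) (z - y).
have h2 := ler_enormD (x - y) (y - z).
move: h1 h2; rewrite !addrA !subrK (enorm_distC z y); lra.
Qed.

Lemma enorm_le_ediam A x y : compact A -> A x -> A y -> enorm (x - y) <= ediam A.
Proof.
move=> cA Ax Ay; apply: ub_le_sup; last by exists x, y.
have [M [_ MA]] := compact_bounded cA.
have {}MA z : A z -> `|z| <= M + 1 by move=> Az; apply: MA => //; rewrite ltrDl.
exists (d%:R * ((M + 1) + (M + 1))) => _ [u [v [Au Av ->]]].
rewrite (le_trans (enorm_le_norm _))// ler_wpM2l//.
by rewrite (le_trans (ler_normB _ _))// lerD ?MA.
Qed.

Lemma eprojP A x : A !=set0 -> compact A ->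
  A (eproj A x) /\ forall q, A q -> enorm (x - eproj A x) <= enorm (x - q).
Proof.
move=> A0 cA; rewrite /eproj.
apply: (@getPex _ [set p | A p /\ forall q, A q -> enorm (x - p) <= enorm (x - q)]).
have [|p pA pmin] := @compact_EVT_min _ R (fun q => enorm (x - q)) A A0 cA.
  by apply: continuous_subspaceT; exact: continuous_enormB.
by rewrite inE in pA; exists p; split => // q Aq; apply: pmin; rewrite inE.
Qed.

(** Segment form of the library's convexity, whose weights are bundled elements of [[0, 1]]. *)
Lemma convex_setE A p q (s : R) :
  convex_set (A : set (convex_lmodType 'rV[R]_d)) ->
  A p -> A q -> 0 <= s <= 1 -> A (p + s *: (q - p)).
Proof.
move=> cA Ap Aq /andP[s0 s1].
have s01 : Itv.spec (@Itv.num_sem R) (Itv.Real `[0%Z, 1%Z]) s.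
  by rewrite /Itv.spec/= /Itv.num_sem/= ger0_real//= in_itv/= s0 s1.
have := cA q p (Itv.mk s01); rewrite !inE => /(_ Aq Ap).
suff -> : (conv (Itv.mk s01) (q : convex_lmodType _) p) = p + s *: (q - p) by [].
rewrite /conv/= scalerBr addrCA; congr (_ + _).
by rewrite scalerBl scale1r.
Qed.

(** Comparing [p] with the points [p + s *: (q - p)] of [A] and dividing by [s] bounds the inner
    product by a multiple of [s], which may be taken small. *)
Lemma eproj_obtuse A x q : A !=set0 -> compact A ->
  convex_set (A : set (convex_lmodType 'rV[R]_d)) -> A q ->
  edot (x - eproj A x) (q - eproj A x) <= 0.
Proof.
move=> A0 cA cvA Aq; have [Ap pmin] := eprojP x A0 cA.
set p := eproj A x in Ap pmin *; set u := x - p; set v := q - p.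
have key s : 0 < s <= 1 -> 2 * edot u v <= s * edot v v.
  move=> /andP[s0 s1].
  have := pmin _ (convex_setE cvA Ap Aq (introT andP (conj (ltW s0) s1))).
  rewrite -/v opprD addrA -/u -(@ler_pXn2r _ 2)// ?nnegrE ?enorm_ge0//.
  rewrite (sqr_enormB u) enormZ exprMn real_normK ?num_real// edotZr => h.
  by rewrite -(ler_pM2l s0) -sqr_enorm; lra.
rewrite leNgt; apply/negP => uv0.
have vv0 : 0 <= edot v v by rewrite -sqr_enorm sqr_ge0.
(* Positive, at most 1, and with [s * edot v v <= edot u v], against [key]. *)
pose s := edot u v / (edot u v + edot v v).
have s01 : 0 < s <= 1.
  by rewrite divr_gt0 ?ltr_wpDr//= ler_pdivrMr ?mul1r ?lerDl// ltr_wpDr.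
have := key _ s01; apply/negP; rewrite -ltNge /s mulrAC ltr_pdivrMr ?ltr_wpDr//.
nra.
Qed.

(** The two obtuse-angle inequalities add up to firm nonexpansiveness ([h3]); Cauchy-Schwarz
    concludes. *)
Lemma eproj_nonexpansive A x y : A !=set0 -> compact A ->
  convex_set (A : set (convex_lmodType 'rV[R]_d)) ->
  enorm (eproj A x - eproj A y) <= enorm (x - y).
Proof.
move=> A0 cA cvA.
have [Ax _] := eprojP x A0 cA; have [Ay _] := eprojP y A0 cA.
have h1 := eproj_obtuse x A0 cA cvA Ay; have h2 := eproj_obtuse y A0 cA cvA Ax.
set p := eproj A x in Ax h1 h2 *; set q := eproj A y in Ay h1 h2 *.
have h3 : edot (p - q) (p - q) <= edot (x - y) (p - q).
  move: h1 h2; rewrite !edotBl !edotBr (edotC q p); lra.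
have := le_trans h3 (edot_le _ _); rewrite -sqr_enorm expr2.
have [->|p0] := eqVneq (enorm (p - q)) 0; first by rewrite enorm_ge0.
by rewrite ler_pM2r// lt_neqAle eq_sym p0 enorm_ge0.
Qed.

Lemma eproj_id A x : A !=set0 -> compact A -> A x -> eproj A x = x.
Proof.
move=> A0 cA Ax; have [_ /(_ _ Ax)] := eprojP x A0 cA.
rewrite subrr enorm0 => h; apply/esym/eqP; rewrite -subr_eq0; apply/eqP.
by apply: enorm_eq0; apply/eqP; rewrite eq_le h enorm_ge0.
Qed.

(** Meant for the initial vector, which may lie outside the constraint set. *)
Lemma enorm_le_edist_set A x y : compact A -> A y ->
  enorm (x - y) <= ediam A + edist_set x A.
Proof.
move=> cA Ay; rewrite -lerBlDl; apply: lb_le_inf; first by exists (enorm (x - y)), y.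
move=> _ [z Az <-]; have h1 := enorm_le_ediam cA Az Ay.
have := ler_enormD (x - z) (z - y); rewrite addrA subrK; lra.
Qed.

End projection.

(** * Averaging by a doubly stochastic matrix *)

Section mixing.
Context {R : realType}.

(** [sup] is meaningful only on bounded sets; on the unit ball every coordinate is at most 1, so the
    sum of the row norms is a bound. *)
Lemma spectral_norm_has_ubound m n (A : 'M[R]_(m, n)) :
  has_ubound [set enorm (v *m A^T) | v in [set v : 'rV[R]_n | enorm v <= 1]].
Proof.
exists (\sum_j enorm (row j A^T)) => _ [v v1 <-].
rewrite mulmx_sum_row (le_trans (ler_enorm_sum _ _))// ler_sum// => j _.
by rewrite enormZ ler_piMl ?enorm_ge0// (le_trans (ler_coord_enorm _ _)).
Qed.

Lemma spectral_norm_ge0 m n (A : 'M[R]_(m, n)) : 0 <= spectral_norm A.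
Proof.
apply: (ub_le_sup (spectral_norm_has_ubound A)); exists 0 => /=.
  by rewrite enorm0.
by rewrite mul0mx enorm0.
Qed.

Lemma spectral_normP m n (A : 'M[R]_(m, n)) (v : 'rV[R]_n) :
  enorm (v *m A^T) <= spectral_norm A * enorm v.
Proof.
have [v0|v0] := eqVneq (enorm v) 0.
  by rewrite v0 mulr0 (enorm_eq0 v0) mul0mx enorm0.
have {}v0 : 0 < enorm v by rewrite lt_neqAle eq_sym v0 enorm_ge0.
rewrite -ler_pdivrMr// mulrC -[X in X * _]ger0_norm ?invr_ge0 ?enorm_ge0//.
rewrite -enormZ scalemxAl; apply: (ub_le_sup (spectral_norm_has_ubound A)).
exists ((enorm v)^-1 *: v) => //=.
by rewrite enormZ ger0_norm ?invr_ge0 ?enorm_ge0// mulVf// gt_eqF.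
Qed.

Lemma mean_mixing n d (W : 'M[R]_n) (z : 'I_n -> 'rV[R]_d) :
  doubly_stochastic W -> \sum_i \sum_k W i k *: z k = \sum_k z k.
Proof.
move=> [_ _ W1]; rewrite exchange_big/=; apply: eq_bigr => k _.
by rewrite -scaler_suml W1 scale1r.
Qed.

(** Rows of [W] sum to 1 and the deviations [z k - m] sum to 0, so on deviations [W] acts as [W]
    minus the averaging matrix; the spectral norm then applies to each of the [d] coordinates
    separately. *)
Lemma mixing_contraction n d (W : 'M[R]_n) (z : 'I_n -> 'rV[R]_d) :
  (0 < n)%N -> doubly_stochastic W ->
  let m := n%:R^-1 *: \sum_k z k in
  l2norm (fun i => enorm ((\sum_k W i k *: z k) - m)) <=
  spectral_norm (W - n%:R^-1 *: const_mx 1) * l2norm (fun k => enorm (z k - m)).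
Proof.
move=> n0 [W0 W1 W1'] /=; set m := n%:R^-1 *: \sum_k z k.
set A := W - _; set rho := spectral_norm A.
have rho0 : 0 <= rho := spectral_norm_ge0 A.
have m0 : \sum_k (z k - m) = 0.
  rewrite sumrB sumr_const card_ord /m -scaler_nat scalerA.
  by rewrite divff ?scale1r ?subrr// pnatr_eq0 -lt0n.
rewrite -(@ler_pXn2r _ 2)// ?nnegrE ?mulr_ge0 ?l2norm_ge0//.
rewrite exprMn !sqr_l2norm.
(* The [j]-th coordinates of all deviations form the vector of length [n] on which the matrix
   acts. *)
pose v j := \row_k (z k - m) 0 j.
have sq (u : 'rV[R]_d) : enorm u ^+ 2 = \sum_j u 0 j ^+ 2.
  by rewrite (sqr_l2norm (fun j => u 0 j)).
have sqn (u : 'rV[R]_n) : enorm u ^+ 2 = \sum_j u 0 j ^+ 2.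
  by rewrite (sqr_l2norm (fun j => u 0 j)).
have -> : \sum_k enorm (z k - m) ^+ 2 = \sum_j enorm (v j) ^+ 2.
  rewrite (eq_bigr _ (fun k _ => sq (z k - m))) exchange_big/=.
  by apply: eq_bigr => j _; rewrite sqn; apply: eq_bigr => k _; rewrite [in RHS]mxE.
have -> : \sum_i enorm (\sum_k W i k *: z k - m) ^+ 2 =
    \sum_j enorm (v j *m A^T) ^+ 2.
  rewrite (eq_bigr _ (fun i _ => sq (\sum_k W i k *: z k - m))) exchange_big/=.
  apply: eq_bigr => j _; rewrite sqn; apply: eq_bigr => i _; congr (_ ^+ 2).
  have -> : \sum_k W i k *: z k - m = \sum_k (W i k - n%:R^-1) *: (z k - m).
    transitivity (\sum_k W i k *: (z k - m) - n%:R^-1 *: \sum_k (z k - m)).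
      rewrite m0 scaler0 subr0; under [RHS]eq_bigr do rewrite scalerBr.
      by rewrite sumrB -scaler_suml W1 scale1r.
    by rewrite scaler_sumr -sumrB; apply: eq_bigr => k _; rewrite scalerBl.
  rewrite summxE mxE; apply: eq_bigr => k _.
  by rewrite !mxE mulr1 mulrC.
rewrite mulr_sumr; apply: ler_sum => j _; rewrite -exprMn.
by rewrite ler_pXn2r// ?nnegrE ?mulr_ge0 ?enorm_ge0// spectral_normP.
Qed.

End mixing.

(** * Smooth functions, Taylor polynomials on coordinate lines, averages *)

Section smooth.
Context {R : realType} {d : nat}.
Implicit Types (x y : 'rV[R]_d) (F : 'rV[R]_d -> R).

Lemma partial_lipschitz Lbar F j x y : smooth2 Lbar F ->
  `|partial j F x - partial j F y| <= Lbar * enorm (x - y).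
Proof.
move=> [_ FL]; apply: le_trans (FL x y).
by have := ler_coord_enorm (grad F x - grad F y) j; rewrite !mxE.
Qed.

Lemma ler_partial_enorm F j x : `|partial j F x| <= enorm (grad F x).
Proof. by have := ler_coord_enorm (grad F x) j; rewrite mxE. Qed.

Lemma is_derive_line F x j (s : R) : (forall y, differentiable F y) ->
  is_derive s 1 (fun s : R => F (x + s *: delta_mx 0 j))
    (partial j F (x + s *: delta_mx 0 j)).
Proof.
move=> dF; set y := x + _.
have E : (fun h : R => h^-1 *: ((fun s : R => F (x + s *: delta_mx 0 j)) (h *: 1 + s) -
      F y)) = (fun h : R => h^-1 *: (F (h *: delta_mx 0 j + y) - F y)).
  apply/funext => h; congr (_ *: (F _ - _)); rewrite /y.
  by rewrite [h *: 1]mulr1 scalerDl addrCA.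
have dv := @diff_derivable _ _ _ _ y (delta_mx 0 j) (dF y).
split; last by rewrite /derive /= E.
by rewrite /derivable /= E.
Qed.

(** Mean value theorem on [[-a, a]], where the derivative differs from the one at [x] by at most
    [Lbar * |a|]. Divided by [2 h], the bound stays finite as [h] tends to 0. *)
Lemma smooth_coord_diff Lbar F j x a : smooth2 Lbar F ->
  `|F (x + a *: delta_mx 0 j) - F (x - a *: delta_mx 0 j)| <=
    2 * `|a| * (`|partial j F x| + Lbar * `|a|).
Proof.
move=> sF; wlog a0 : a / 0 <= a => [hwlog|].
  have [|a0] := leP 0 a; first exact: hwlog.
  have /hwlog : 0 <= - a by lra.
  by rewrite !scaleNr opprK normrN distrC.
rewrite -scaleNr; pose phi s := F (x + s *: delta_mx 0 j).
have [dF _] := sF.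
have aa : - a <= a by lra.
have phi' (s : R) : is_derive s (1 : R) phi (partial j F (x + s *: delta_mx 0 j)).
  exact: is_derive_line.
have [|c ca ->] := MVT_segment aa (fun s _ => phi' s).
  apply: continuous_subspaceT => s.
  by apply: differentiable_continuous; apply/derivable1_diffP; case: (phi' s).
rewrite normrM mulrC (_ : `|a - - a| = 2 * `|a|).
  rewrite ler_wpM2l ?mulr_ge0//.
  rewrite -[X in `|X|](subrK (partial j F x)) (le_trans (ler_normD _ _))//.
  rewrite addrC lerD2l (le_trans (partial_lipschitz _ _ _ sF))//.
  have -> : x + c *: delta_mx 0 j - x = c *: (delta_mx 0 j : 'rV[R]_d).
    by rewrite addrC addKr.
  (* Two points at distance 1 show that a Lipschitz constant is nonnegative. *)
  have L0 : 0 <= Lbar.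
    have [_ /(_ (x + delta_mx 0 j) x)] := sF.
    have -> : x + delta_mx 0 j - x = 1 *: (delta_mx 0 j : 'rV[R]_d).
      by rewrite addrC addKr scale1r.
    by rewrite enorm_delta normr1 mulr1; apply: le_trans; exact: enorm_ge0.
  rewrite enorm_delta ler_wpM2l// (ger0_norm a0) ler_norml.
  by move: ca; rewrite in_itv.
have -> : a - - a = 2 * a by ring.
by rewrite normrM normr_nat.
Qed.

Lemma smooth2_grad_continuous Lbar F j : smooth2 Lbar F -> continuous (partial j F).
Proof.
move=> sF; apply: (@enorm_lipschitz_continuous _ _ _ Lbar) => x y.
exact: partial_lipschitz.
Qed.

End smooth.

Section taylor.
Context {R : realType} {d : nat}.
Implicit Types (x y : 'rV[R]_d) (F : 'rV[R]_d -> R).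

(** On a coordinate line only multi-indices supported on [j] contribute. Only the linear coefficient
    is identified, since kernel moments will annihilate the others. *)
Lemma taylor_line l F x j : exists c : nat -> R,
  ((0 < l)%N -> c 1%N = partial j F x) /\
  forall s, taylor l F x (x + s *: delta_mx 0 j) = \sum_(p < l.+1) c p * s ^+ p.
Proof.
pose h (p : 'I_l.+1) : {ffun 'I_d -> 'I_l.+1} :=
  [ffun i => if i == j then p else ord0].
pose cf (m : {ffun 'I_d -> 'I_l.+1}) := (\prod_j (m j)`!)%:R^-1 * @mpartial R d l m F x.
exists (fun p => cf (h (inord p))); split.
  move=> l0; rewrite /cf (bigD1 j)//= big1 => [|i ij]; last first.
    by rewrite ffunE (negbTE ij).
  rewrite ffunE eqxx inordK ?ltnS// invr1 mul1r /mpartial.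
  have jin : j \in enum 'I_d by rewrite mem_enum.
  suff H s : uniq s -> foldr (fun j0 H => iter (h (inord 1) j0) (partial j0) H) F s =
      if j \in s then partial j F else F by rewrite H ?jin// enum_uniq.
  elim: s => //= i s IH /andP[iNs us]; rewrite IH// ffunE in_cons eq_sym.
  case: eqVneq iNs => [->|ij] iNs /=; last by [].
  by rewrite inordK ?ltnS// (negbTE iNs).
move=> s; rewrite /taylor.
have zx i : (x + s *: delta_mx 0 j) 0 i - x 0 i = if i == j then s else 0.
  by rewrite !mxE addrC addKr eqxx/=; case: eqP => _; rewrite ?mulr1 ?mulr0.
rewrite (bigID (fun m : {ffun 'I_d -> 'I_l.+1} => m == h (m j)))/= [X in _ + X]big1 => [|m /andP[_ mh]].
  rewrite addr0 (reindex_onto h (fun m : {ffun 'I_d -> 'I_l.+1} => m j))/=; last first.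
    by move=> m /andP[_ /eqP].
  rewrite (eq_bigl xpredT) => [|p]; last first.
    rewrite ffunE !eqxx !andbT (bigD1 j)//= ffunE eqxx big1 ?addn0.
      by rewrite -ltnS ltn_ord.
    by move=> i ij; rewrite ffunE (negbTE ij).
  apply: eq_bigr => p _; rewrite inord_val; congr (_ * _).
  rewrite (bigD1 j)//= zx eqxx ffunE eqxx big1 ?mulr1// => i ij.
  by rewrite ffunE (negbTE ij) expr0.
(* An index not of the form [h p] has a nonzero entry at some [i != j], where the displacement is
   0. *)
have [i ij mi] : exists2 i, i != j & m i != ord0.
  apply/exists_inP; apply: contraNT mh => /exists_inPn H; apply/eqP/ffunP => i.
  rewrite ffunE; case: eqVneq => [->//|ij]; apply/eqP.
  by have := H i ij; rewrite negbK.
rewrite [X in _ * X](bigD1 i)//= zx (negbTE ij) expr0n.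
by rewrite (_ : (m i == 0%N :> nat) = false) ?mul0r ?mulr0//; apply/negbTE.
Qed.

End taylor.

Section average.
Context {R : realType} {n d : nat}.
Implicit Types (x y : 'rV[R]_d) (f : 'I_n -> 'rV[R]_d -> R).

Lemma grad_average f x : (forall i y, differentiable (f i) y) ->
  grad (average_fun f) x = n%:R^-1 *: \sum_i grad (f i) x.
Proof.
move=> df; apply/rowP => j; rewrite !mxE summxE /partial.
have -> : average_fun f = n%:R^-1 \*: (\sum_i f i).
  by apply/funext => y; rewrite /average_fun /= fct_sumE.
rewrite deriveZ; last first.
  by apply: derivable_sum => i; apply: diff_derivable; exact: df.
rewrite derive_sum => [|i]; last by apply: diff_derivable; exact: df.
by congr (_ * _); apply: eq_bigr => i _; rewrite mxE.
Qed.

Lemma smooth2_average Lbar f : (0 < n)%N -> (forall i, smooth2 Lbar (f i)) ->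
  smooth2 Lbar (average_fun f).
Proof.
move=> n0 sf; have df i y : differentiable (f i) y by have [] := sf i.
split=> [x|x y].
  have -> : average_fun f = n%:R^-1 \*: (\sum_i f i).
    by apply/funext => y; rewrite /average_fun /= fct_sumE.
  by apply: differentiableZ; apply: differentiable_sum.
rewrite !grad_average// -scalerBr -sumrB enormZ ger0_norm ?invr_ge0//.
rewrite ler_pdivrMl ?ltr0n// (le_trans (ler_enorm_sum _ _))//.
apply: (@le_trans _ _ (\sum_(i < n) Lbar * enorm (x - y))).
  by apply: ler_sum => i _; have [_] := sf i; apply.
by rewrite sumr_const card_ord mulr_natl.
Qed.

(** [max_grad] is a supremum and bounds its members only if their set is bounded; Lipschitz
    gradients on a set of finite diameter ensure this. *)
Lemma grad_le_max_grad Lbar f A i x : compact A ->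
  (forall i, smooth2 Lbar (f i)) -> A x ->
  enorm (grad (f i) x) <= max_grad f A.
Proof.
move=> cA sf Ax; apply: ub_le_sup; last by exists i, x.
(* The sum over the agents stands in for a maximum. *)
exists (\sum_i (enorm (grad (f i) x) + `|Lbar| * ediam A)).
move=> _ [k [y [Ay ->]]].
rewrite (bigD1 k)//= (@le_trans _ _ (enorm (grad (f k) x) + `|Lbar| * ediam A))//.
  rewrite -(subrK (grad (f k) x) (grad (f k) y)) (le_trans (ler_enormD _ _))//.
  rewrite addrC lerD2l; have [_ /(_ y x)] := sf k.
  move/le_trans; apply; rewrite (@le_trans _ _ (`|Lbar| * enorm (y - x)))//.
    by rewrite ler_wpM2r ?enorm_ge0 ?ler_norm.
  by rewrite ler_wpM2l// enorm_le_ediam.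
rewrite lerDl sumr_ge0// => m _; rewrite addr_ge0 ?enorm_ge0// mulr_ge0//.
by rewrite (le_trans _ (enorm_le_ediam cA Ax Ax))// enorm_ge0.
Qed.

End average.

(** * Strong convexity and first-order optimality *)

Section strongly_convex.
Context {R : realType} {d : nat}.
Implicit Types (x y : 'rV[R]_d) (F : 'rV[R]_d -> R).

Lemma strongly_convex_ge alpha F x y : 0 <= alpha -> strongly_convex alpha F ->
  edot (grad F y) (x - y) <= F x - F y.
Proof.
move=> a0 [_ /(_ x y)]; apply: le_trans.
by rewrite lerDl mulr_ge0 ?sqr_ge0// divr_ge0.
Qed.

(** Jensen's inequality from the tangent at the mean, whose linear terms sum to zero; it serves the
    time average. *)
Lemma strongly_convex_mean alpha F (I : finType) (x : I -> 'rV[R]_d) :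
  (0 < #|I|)%N -> 0 <= alpha -> strongly_convex alpha F ->
  #|I|%:R * F (#|I|%:R^-1 *: \sum_i x i) <= \sum_i F (x i).
Proof.
move=> I0 a0 cF; set m := _ *: _; rewrite -subr_ge0.
have -> : \sum_i F (x i) - #|I|%:R * F m = \sum_i (F (x i) - F m).
  by rewrite sumrB sumr_const mulr_natl.
apply: (@le_trans _ _ (\sum_i edot (grad F m) (x i - m))); last first.
  by apply: ler_sum => i _; exact: strongly_convex_ge a0 cF.
rewrite -edot_sumr sumrB sumr_const -scaler_nat /m scalerA.
by rewrite divff ?pnatr_eq0 -?lt0n// scale1r subrr edot0r.
Qed.

(** Strong monotonicity against the Lipschitz bound, on one unit vector. It lets [Lbar] replace
    [alpha], which keeps the final constant free of [alpha]. *)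
Lemma strongly_convex_smooth_le alpha Lbar F : (0 < d)%N ->
  strongly_convex alpha F -> smooth2 Lbar F -> alpha <= Lbar.
Proof.
case: d F => // d' F _ [_ cF] [_ sF].
pose e : 'rV[R]_d'.+1 := delta_mx 0 ord0.
have e1 : enorm e = 1 by rewrite -[e]scale1r enorm_delta normr1.
have := cF e 0; have := cF 0 e; have := sF e 0.
rewrite !subr0 !sub0r edotNr enormN e1 expr1n mulr1.
have := edot_le (grad F e - grad F 0) e.
rewrite edotBl e1; lra.
Qed.

(** Convexity at [z = x + s v] and minimality of [x] give [<grad F z, v> >= 0]; the Lipschitz
    gradient carries this back to [x] up to [s * D], with [s] arbitrarily small. *)
Lemma first_order_optimality alpha Lbar F (A : set 'rV[R]_d) x y :
  0 <= alpha -> 0 <= Lbar -> strongly_convex alpha F -> smooth2 Lbar F ->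
  convex_set (A : set (convex_lmodType 'rV[R]_d)) ->
  A x -> (forall z, A z -> F x <= F z) -> A y -> 0 <= edot (grad F x) (y - x).
Proof.
move=> a0 L0 cF sF cA Ax xmin Ay.
set v := y - x; set D := Lbar * enorm v ^+ 2.
have D0 : 0 <= D by rewrite mulr_ge0 ?sqr_ge0.
have key s : 0 < s <= 1 -> - (s * D) <= edot (grad F x) v.
  move=> /andP[s0 s1].
  have Az := convex_setE cA Ax Ay (introT andP (conj (ltW s0) s1)).
  rewrite -/v in Az; set z := x + s *: v in Az.
  have h1 : 0 <= edot (grad F z) v.
    have := le_trans (strongly_convex_ge x z a0 cF) _ (y := F x - F z).
    move=> /(_ 0); rewrite subr_le0 => /(_ (xmin _ Az)).
    have -> : x - z = - s *: v by rewrite /z opprD addrA subrr add0r scaleNr.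
    by rewrite edotZr mulNr oppr_le0 pmulr_rge0.
  have h2 := edot_ge (grad F x - grad F z) v.
  have [_ /(_ x z) h3] := sF.
  have h4 : enorm (x - z) = s * enorm v.
    by rewrite /z opprD addrA subrr add0r enormN enormZ ger0_norm// ltW.
  have h5 : enorm (grad F x - grad F z) * enorm v <= s * D.
    rewrite (le_trans (ler_wpM2r (enorm_ge0 _) h3))// h4 /D; lra.
  move: h2; rewrite edotBl; lra.
rewrite leNgt; apply/negP => neg; set g := edot _ _ in key neg.
(* As [g < 0], this value of [s] satisfies [s * D < - g]. *)
have s01 : 0 < - g / (D - g) <= 1.
  by rewrite divr_gt0/= ?ler_pdivrMr ?mul1r; lra.
have := key _ s01; apply/negP; rewrite -ltNge.
rewrite ltrNr mulrAC ltr_pdivrMr; last by lra.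
nra.
Qed.

End strongly_convex.

(** * Pathwise regret bound for arbitrary gradient estimates *)

Section regret.
Context {R : realType} {n d : nat} (Theta : set 'rV[R]_d) (W : 'M[R]_n)
  (f : 'I_n -> 'rV[R]_d -> R) (g x : 'I_n -> nat -> 'rV[R]_d)
  (x1 xs : 'rV[R]_d) (alpha Lbar D M : R).
Local Notation F := (average_fun f).
Local Notation rho := (spectral_norm (W - n%:R^-1 *: const_mx 1)).
Local Notation mean u := ((n%:R : R)^-1 * \sum_k u k).
Let z k t := eproj Theta (x k t - (2 / (alpha * t%:R)) *: g k t).
Let xb t := n%:R^-1 *: \sum_k x k t.
Let S t := F (xb t) - F xs.
Let V t := mean (fun k => enorm (x k t - xs) ^+ 2).
Let q t := mean (fun k => enorm (g k t) ^+ 2).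
(** Root mean square consensus error; the normalization keeps the recursion free of the number of
    agents. *)
Let delta t := Num.sqrt n%:R^-1 * l2norm (fun k => enorm (x k t - xb t)).

Hypotheses (n0 : (0 < n)%N) (d0 : (0 < d)%N) (alpha0 : 0 < alpha).
Hypotheses (Theta0 : Theta !=set0) (cTheta : compact Theta)
  (cvTheta : convex_set (Theta : set (convex_lmodType 'rV[R]_d))).
Hypotheses (sf : forall i, smooth2 Lbar (f i)) (cF : strongly_convex alpha F).
Hypotheses (WS : doubly_stochastic W) (rho1 : rho < 1).
Hypotheses (Txs : Theta xs) (xsmin : forall y, Theta y -> F xs <= F y).
Hypotheses (xinit : forall k, x k 1%N = x1)
  (xstep : forall k t, (1 <= t)%N -> x k t.+1 = \sum_l W k l *: z l t).
Hypotheses (xD : forall k t, (1 <= t)%N -> enorm (x k t - xs) <= D)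
  (fM : forall k t, (1 <= t)%N -> enorm (grad (f k) (x k t)) <= M)
  (fMs : forall k, enorm (grad (f k) xs) <= M).

Let nR0 : 0 < n%:R :> R. Proof. by rewrite ltr0n. Qed.
Let nV0 : 0 <= n%:R^-1 :> R. Proof. by rewrite invr_ge0 ltW. Qed.
Let sF : smooth2 Lbar F. Proof. exact: smooth2_average. Qed.
Let alphaL : alpha <= Lbar. Proof. exact: strongly_convex_smooth_le cF sF. Qed.
Let L0 : 0 <= Lbar. Proof. by apply: le_trans alphaL; exact: ltW. Qed.

Let i0 : 'I_n := Ordinal n0.

Let D0 : 0 <= D.
Proof. by apply: le_trans (xD i0 (leqnn 1)); exact: enorm_ge0. Qed.

Let M0 : 0 <= M.
Proof. by apply: le_trans (fMs i0); exact: enorm_ge0. Qed.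

Let mean_le (u v : 'I_n -> R) : (forall k, u k <= v k) -> mean u <= mean v.
Proof. by move=> uv; rewrite ler_wpM2l// ler_sum. Qed.

Let mean_cst (c : R) : mean (fun _ : 'I_n => c) = c.
Proof. by rewrite sumr_const card_ord -[c *+ n]mulr_natl mulKf// gt_eqF. Qed.

Let meanD (u v : 'I_n -> R) : mean (fun k => u k + v k) = mean u + mean v.
Proof. by rewrite big_split mulrDr. Qed.

Let xb_step t : (1 <= t)%N -> xb t.+1 = n%:R^-1 *: \sum_k z k t.
Proof.
move=> t1; rewrite /xb -[in RHS](mean_mixing (fun k => z k t) WS); congr (_ *: _).
by apply: eq_bigr => k _; exact: xstep.
Qed.

Let sqr_delta t : delta t ^+ 2 = mean (fun k => enorm (x k t - xb t) ^+ 2).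
Proof. by rewrite exprMn sqr_sqrtr// sqr_l2norm. Qed.

Let delta_ge0 t : 0 <= delta t.
Proof. by rewrite mulr_ge0 ?sqrtr_ge0 ?l2norm_ge0. Qed.

Let mean_enorm_le t : mean (fun k => enorm (x k t - xb t)) <= delta t.
Proof.
have := l2norm_cauchy_schwarz (fun k => enorm (x k t - xb t)) (fun=> 1).
under eq_bigr do rewrite mulr1.
move/(ler_wpM2l nV0)/le_trans; apply.
rewrite mulrCA mulrC /delta ler_wpM2r ?l2norm_ge0//.
rewrite /l2norm; under eq_bigr do rewrite expr1n.
rewrite sumr_const card_ord -[X in X * _]sqr_sqrtr// expr2 -mulrA.
by rewrite -sqrtrM// mulVf ?gt_eqF// sqrtr1 mulr1.
Qed.

Let V_split t : V t = delta t ^+ 2 + enorm (xb t - xs) ^+ 2.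
Proof.
by rewrite sqr_delta /V (sum_sqr_enorm_mean _ _ n0) mulrDr mulKf// gt_eqF.
Qed.

Let delta_le t : (1 <= t)%N -> delta t <= D.
Proof.
move=> t1; rewrite -(@ler_pXn2r _ 2)// ?nnegrE//.
apply: (@le_trans _ _ (V t)); first by rewrite V_split lerDl sqr_ge0.
rewrite -[leRHS]mean_cst; apply: mean_le => k.
by rewrite ler_pXn2r ?nnegrE ?enorm_ge0// xD.
Qed.

Let xb_le t : (1 <= t)%N -> enorm (xb t - xs) <= D.
Proof.
move=> t1; rewrite -(@ler_pXn2r _ 2)// ?nnegrE ?enorm_ge0//.
apply: (@le_trans _ _ (V t)); first by rewrite V_split lerDr sqr_ge0.
rewrite -[leRHS]mean_cst; apply: mean_le => k.
by rewrite ler_pXn2r ?nnegrE ?enorm_ge0// xD.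
Qed.

(* Nonexpansiveness of the projection is used against the single point
   [eproj Theta (xb t)], so that [x1] need not lie in [Theta]. *)
Let consensus t : (1 <= t)%N ->
  delta t.+1 <= rho * delta t + (1 + q t) / (alpha * t%:R).
Proof.
move=> t1; set eta := 2 / (alpha * t%:R).
have tR : 0 < t%:R :> R by rewrite ltr0n.
have eta0 : 0 < eta by rewrite divr_gt0 ?mulr_gt0.
have rho0 := spectral_norm_ge0 (W - n%:R^-1 *: const_mx 1).
pose s := Num.sqrt (n%:R : R)^-1; have s0 : 0 <= s := sqrtr_ge0 _.
pose gam := s * l2norm (fun k => enorm (g k t)).
have gam2 : gam ^+ 2 = q t by rewrite exprMn sqr_sqrtr// sqr_l2norm.
have h1 : delta t.+1 <= rho * (s * l2norm (fun k => enorm (z k t - xb t.+1))).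
  rewrite /delta -/s mulrCA ler_wpM2l//.
  have := mixing_contraction (fun k => z k t) n0 WS.
  rewrite /= -(xb_step t1); apply: le_trans.
  by under eq_fun do rewrite xstep//.
have h2 : l2norm (fun k => enorm (z k t - xb t.+1)) <=
    l2norm (fun k => enorm (z k t - eproj Theta (xb t))).
  rewrite ler_sqrt ?sumr_ge0// => [|i _]; last exact: sqr_ge0.
  rewrite (sum_sqr_enorm_mean _ (eproj Theta (xb t)) n0) -(xb_step t1).
  by rewrite lerDl mulr_ge0 ?sqr_ge0// ltW.
have h3 : l2norm (fun k => enorm (z k t - eproj Theta (xb t))) <=
    l2norm (fun k => enorm (x k t - xb t) + eta * enorm (g k t)).
  apply: l2norm_le => k.
  have eg : 0 <= eta * enorm (g k t) by rewrite mulr_ge0 ?enorm_ge0// ltW.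
  rewrite ler_pXn2r ?nnegrE ?(addr_ge0 (enorm_ge0 _) eg) ?enorm_ge0//.
  rewrite (le_trans (eproj_nonexpansive _ _ Theta0 cTheta cvTheta))// addrAC.
  by rewrite (le_trans (ler_enormB _ _))// enormZ gtr0_norm.
have h4 := le_trans (le_trans h2 h3) (l2normD _ _).
rewrite (l2normZ eta) gtr0_norm// in h4.
have h5 : delta t.+1 <= rho * (delta t + eta * gam).
  rewrite (le_trans h1)// ler_wpM2l// (le_trans (ler_wpM2l s0 h4))//.
  by rewrite mulrDr mulrCA.
rewrite (le_trans h5)// mulrDr lerD2l.
have gam0 : 0 <= gam by rewrite mulr_ge0 ?l2norm_ge0.
rewrite (@le_trans _ _ (eta * gam))//.
  by apply: ler_piMl; [rewrite mulr_ge0// ltW|exact: ltW].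
have A0 : 0 <= (alpha * t%:R)^-1 by rewrite invr_ge0 mulr_ge0// ltW.
(* The remaining [2 * gam <= 1 + gam ^ 2] trades the norm for its square, whose expectation is the
   one under control. *)
rewrite /eta mulrAC ler_wpM2r//.
by rewrite -gam2 -subr_ge0 (_ : _ - _ = (gam - 1) ^+ 2) ?sqr_ge0//; ring.
Qed.

(** All agents start at [x1], so [delta 1 = 0]. Keeping the last term [delta T.+1] on the left lets
    the induction pass. *)
Let sum_delta T : (1 - rho) * \sum_(1 <= t < T.+1) delta t <=
  \sum_(1 <= t < T.+1) (1 + q t) / (alpha * t%:R).
Proof.
suff : (1 - rho) * \sum_(1 <= t < T.+1) delta t + delta T.+1 <=
    \sum_(1 <= t < T.+1) (1 + q t) / (alpha * t%:R).
  by apply: le_trans; rewrite lerDl.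
elim: T => [|T IH].
  rewrite !big_geq// mulr0 add0r /delta.
  rewrite (_ : l2norm _ = 0) ?mulr0// /l2norm big1 ?sqrtr0// => k _.
  rewrite (_ : xb 1 = x1) ?xinit ?subrr ?enorm0 ?expr0n//.
  rewrite /xb (eq_bigr _ (fun k _ => xinit k)) sumr_const card_ord.
  by rewrite -(scaler_nat n x1) scalerA mulVf ?scale1r// gt_eqF.
rewrite !(@big_nat_recr _ _ _ T.+1)//=.
by have := consensus (ltn0Sn T); move: ((1 + q T.+1) / _) => a; lra.
Qed.

(** Jensen for the weights [W i k] and nonexpansiveness, with [xs] fixed by the projection, bound
    [V t.+1] by an expanded square; the coefficients on the right are [1 / (2 eta)] and
    [eta / 2]. *)
Let descent t : (1 <= t)%N ->
  mean (fun k => edot (g k t) (x k t - xs)) <=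
  alpha * t%:R / 4 * (V t - V t.+1) + q t / (alpha * t%:R).
Proof.
move=> t1; set eta := 2 / (alpha * t%:R).
have tR : 0 < t%:R :> R by rewrite ltr0n.
have eta0 : 0 < eta by rewrite divr_gt0 ?mulr_gt0.
have h1 : V t.+1 <= mean (fun k => enorm (z k t - xs) ^+ 2).
  rewrite ler_wpM2l//.
  have c0 : \sum_k enorm (z k t - xs) ^+ 2 =
      \sum_i \sum_k W i k * enorm (z k t - xs) ^+ 2.
    rewrite exchange_big/=; apply: eq_bigr => k _.
    by rewrite -mulr_suml; have [_ _ ->] := WS; rewrite mul1r.
  rewrite c0; apply: ler_sum => i _; rewrite xstep//.
  have [W0 W1 _] := WS.
  have -> : \sum_l W i l *: z l t - xs = \sum_l W i l *: (z l t - xs).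
    under [RHS]eq_bigr do rewrite scalerBr.
    by rewrite sumrB -scaler_suml W1 scale1r.
  set u := \sum_l _; rewrite -subr_ge0.
  (* The defect in Jensen's inequality is a weighted variance. *)
  have -> : \sum_k W i k * enorm (z k t - xs) ^+ 2 - enorm u ^+ 2 =
      \sum_k W i k * enorm (z k t - xs - u) ^+ 2.
    under [RHS]eq_bigr do rewrite (sqr_enormB (z _ t - xs)) mulrDr mulrBr.
    rewrite big_split/= sumrB -(mulr_suml _ _ _ (enorm u ^+ 2)) W1 mul1r.
    have -> : \sum_k W i k * (2 * edot (z k t - xs) u) = 2 * enorm u ^+ 2.
      rewrite sqr_enorm [in RHS]/u edot_suml mulr_sumr; apply: eq_bigr => k _.
      by rewrite edotZl mulrCA.
    ring.
  by rewrite sumr_ge0// => k _; rewrite mulr_ge0 ?sqr_ge0.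
have h2 : mean (fun k => enorm (z k t - xs) ^+ 2) <=
    V t - 2 * eta * mean (fun k => edot (g k t) (x k t - xs)) + eta ^+ 2 * q t.
  have -> : V t - 2 * eta * mean (fun k => edot (g k t) (x k t - xs)) +
      eta ^+ 2 * q t = mean (fun k => enorm (x k t - xs) ^+ 2 +
      (- (2 * eta) * edot (g k t) (x k t - xs) + eta ^+ 2 * enorm (g k t) ^+ 2)).
    by rewrite meanD meanD -!mulr_sumr /V /q; ring.
  apply: mean_le => k.
  rewrite -{1}(eproj_id Theta0 cTheta Txs).
  apply: (@le_trans _ _ (enorm (x k t - eta *: g k t - xs) ^+ 2)).
    by rewrite ler_pXn2r ?nnegrE ?enorm_ge0// eproj_nonexpansive.
  have -> : x k t - eta *: g k t - xs = (x k t - xs) - eta *: g k t by rewrite addrAC.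
  rewrite (sqr_enormB (x k t - xs)) edotZr enormZ exprMn real_normK ?num_real// edotC.
  by rewrite le_eqVlt; apply/orP; left; apply/eqP; ring.
have := le_trans h1 h2; set m := mean (fun k => edot (g k t) (x k t - xs)).
have e1 : alpha * t%:R / 4 * (2 * eta) = 1.
  by rewrite /eta; field; rewrite !gt_eqF.
have e2 : alpha * t%:R / 4 * eta ^+ 2 = (alpha * t%:R)^-1.
  by rewrite /eta; field; rewrite !gt_eqF.
have a4 : 0 <= alpha * t%:R / 4 by rewrite divr_ge0// mulr_ge0// ltW.
move/(ler_wpM2l a4); rewrite mulrDr mulrBr.
rewrite [X in _ - X]mulrA e1 mul1r [X in _ + X]mulrA e2; lra.
Qed.

(** Strong convexity is applied at [xb t], but the estimator of agent [k] sees [x k t]. Moving the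
    gradients costs [Lbar * D], moving the arguments [M], and passing from the mean's squared
    distance to [V t] costs [alpha / 2 * delta ^ 2], made linear by [alpha <= Lbar] and
    [delta <= D]. *)
Let gap t : (1 <= t)%N ->
  S t + alpha / 2 * V t <=
  mean (fun k => edot (grad (f k) (x k t)) (x k t - xs)) +
    (Lbar * D + M + Lbar * D / 2) * delta t.
Proof.
move=> t1.
have h1 : S t + alpha / 2 * enorm (xb t - xs) ^+ 2 <=
    edot (grad F (xb t)) (xb t - xs).
  have [_ /(_ xs (xb t))] := cF.
  by rewrite -(opprB (xb t)) edotNr enormN /S; lra.
have h2 : edot (grad F (xb t)) (xb t - xs) <=
    mean (fun k => edot (grad (f k) (x k t)) (x k t - xs) +
      (Lbar * D + M) * enorm (x k t - xb t)).
  rewrite grad_average; last by move=> i y; have [] := sf i.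
  rewrite edotZl edot_suml; apply: mean_le => k.
  set a := grad (f k) (xb t); set b := grad (f k) (x k t).
  have -> : edot a (xb t - xs) = edot b (x k t - xs) +
      (edot (a - b) (xb t - xs) - edot b (x k t - xb t)).
    by rewrite edotBl !edotBr; ring.
  rewrite lerD2l mulrDl lerD//.
    rewrite (le_trans (edot_le _ _))// mulrAC ler_pM ?enorm_ge0 ?xb_le//.
    by rewrite (enorm_distC (x k t)); have [_] := sf k; exact.
  rewrite lerNl (le_trans _ (edot_ge _ _))// lerN2 ler_wpM2r ?enorm_ge0//.
  exact: fM.
have h3 := le_trans h1 h2; rewrite meanD -mulr_sumr mulrCA in h3.
have h4 : (Lbar * D + M) * mean (fun k => enorm (x k t - xb t)) <=
    (Lbar * D + M) * delta t.
  by rewrite ler_wpM2l// addr_ge0// mulr_ge0.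
have h5 : alpha / 2 * delta t ^+ 2 <= Lbar * D / 2 * delta t.
  rewrite expr2 mulrA ler_wpM2r// mulrAC ler_wpM2r//.
  by rewrite ler_pM ?delta_le// ltW.
rewrite V_split; lra.
Qed.

(** Strong convexity at [xs]. From time 2 on, [xb t] averages projected points, so the gradient term
    is nonnegative by optimality. At time 1 it is at least [- M * D], and [1 <= Lbar / alpha] turns
    this into the [1 / (alpha t)] term. *)
Let gap_ge t : (1 <= t)%N ->
  alpha / 2 * V t - Lbar * D / 2 * delta t - M * D * Lbar / (alpha * t%:R) <= S t.
Proof.
move=> t1; have tR : 0 < t%:R :> R by rewrite ltr0n.
have h1 : edot (grad F xs) (xb t - xs) + alpha / 2 * enorm (xb t - xs) ^+ 2 <= S t.
  by have [_ /(_ (xb t) xs)] := cF.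
have h2 : - (M * D * Lbar / (alpha * t%:R)) <= edot (grad F xs) (xb t - xs).
  case: t t1 tR h1 => [//|[|t]] _ tR h1.
    rewrite (le_trans _ (edot_ge _ _))// lerN2.
    have MDL : M * D <= M * D * Lbar / (alpha * 1).
      by rewrite mulr1 -mulrA ler_peMr ?mulr_ge0// ler_pdivlMr// mul1r.
    apply: le_trans MDL; rewrite ler_pM ?enorm_ge0 ?xb_le//.
    rewrite grad_average; last by move=> i y; have [] := sf i.
    rewrite enormZ ger0_norm// (@le_trans _ _ (mean (fun k => enorm (grad (f k) xs))))//.
      by rewrite ler_wpM2l// ler_enorm_sum.
    by rewrite -[leRHS]mean_cst; exact: mean_le.
  apply: (@le_trans _ _ 0).
    by rewrite oppr_le0 divr_ge0 ?mulr_ge0// ltW.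
  rewrite xb_step//.
  have -> : n%:R^-1 *: (\sum_k z k t.+1) - xs = n%:R^-1 *: \sum_k (z k t.+1 - xs).
    rewrite sumrB sumr_const card_ord -(scaler_nat n xs) scalerBr scalerA.
    by rewrite mulVf ?scale1r// gt_eqF.
  rewrite edotZr mulr_ge0// edot_sumr sumr_ge0// => k _.
  have [zT _] := eprojP (x k t.+1 - (2 / (alpha * t.+1%:R)) *: g k t.+1) Theta0 cTheta.
  exact: first_order_optimality (ltW alpha0) L0 cF sF cvTheta Txs xsmin zT.
have h5 : alpha / 2 * delta t ^+ 2 <= Lbar * D / 2 * delta t.
  rewrite expr2 mulrA ler_wpM2r// mulrAC ler_wpM2r//.
  by rewrite ler_pM ?delta_le// ltW.
rewrite V_split; lra.
Qed.

(* [Lyap] collects the part of the step whose expectation is controlled by the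
   bias of the gradient estimators. The factor 1/2 appears because the kernel is
   normalized by Lebesgue measure and not by the law of [r]. *)
Let Lyap t := mean (fun k => \sum_j
  ((2^-1 * partial j (f k) (x k t) - g k t 0 j) * (x k t 0 j - xs 0 j) -
   alpha / 8 * (x k t 0 j - xs 0 j) ^+ 2)).

Let c3 := Lbar * D + M + Lbar * D.
Let c1 := 1 + M * D * Lbar.

(** Half of [gap], all of [descent], a quarter of [gap_ge]. The first keeps [alpha / 8 * V t] after
    [Lyap] takes its share, the last supplies as much again, and together they lower the weight of
    [V t] from [t] to [t - 1]. *)
Let step t : (1 <= t)%N ->
  S t / 4 <= alpha / 4 * (t.-1%:R * V t - t%:R * V t.+1) + Lyap t +
    c3 * delta t + c1 * ((1 + q t) / (alpha * t%:R)).
Proof.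
move=> t1; have tR : 0 < t%:R :> R by rewrite ltr0n.
have -> : Lyap t = 2^-1 * mean (fun k => edot (grad (f k) (x k t)) (x k t - xs)) -
    mean (fun k => edot (g k t) (x k t - xs)) - alpha / 8 * V t.
  rewrite /V /Lyap mulrCA -mulrBr [alpha / 8 * _]mulrCA -mulrBr; congr (_ * _).
  rewrite !mulr_sumr -!sumrB; apply: eq_bigr => k _.
  rewrite sqr_enorm /edot !mulr_sumr -!sumrB; apply: eq_bigr => j _.
  by rewrite !mxE; ring.
have h1 := gap t1; have h2 := gap_ge t1; have h3 := descent t1.
have -> : t.-1%:R = t%:R - 1 :> R by rewrite -subn1 natrB.
have A0 : 0 <= (alpha * t%:R)^-1 by rewrite invr_ge0 mulr_ge0// ltW.
have q0 : 0 <= q t by rewrite mulr_ge0 ?sumr_ge0// => k _; exact: sqr_ge0.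
have MDL : 0 <= M * D * Lbar by apply: mulr_ge0 => //; exact: mulr_ge0.
move: A0 h1 h2 h3; rewrite /c3 /c1.
set A := (alpha * t%:R)^-1; set m := mean (fun k => edot (grad (f k) (x k t)) (x k t - xs)).
set m' := mean (fun k => edot (g k t) (x k t - xs)) => A0 h1 h2 h3.
have p1 : 0 <= M * D * Lbar * A by rewrite mulr_ge0.
have p2 : 0 <= M * D * Lbar * (q t * A) by apply: mulr_ge0 => //; exact: mulr_ge0.
have p3 : 0 <= q t * A by apply: mulr_ge0.
have p4 : 0 <= M * delta t by apply: mulr_ge0.
have p5 : 0 <= Lbar * D * delta t by apply: mulr_ge0 => //; exact: mulr_ge0.
move: p1 p2 p3 p4 p5 A0 h1 h2 h3; clearbody m m' A.
move: (S t) (V t) (V t.+1) (delta t) (q t) (t%:R : R) => s v v' de qt r.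
lra.
Qed.

(** The weights make the distances telescope to a nonpositive number, with no trace of the initial
    one. Consensus costs [1 / (1 - rho)]; the [c1] terms are charged the same factor, which is at
    least 1. *)
Lemma sum_gap_le T :
  \sum_(1 <= t < T.+1) S t <= \sum_(1 <= t < T.+1)
    (4 * Lyap t + 4 * (c1 + c3) / (alpha * (1 - rho)) * ((1 + q t) / t%:R)).
Proof.
have rho0 : 0 < 1 - rho by rewrite subr_gt0.
have rho_ge0 := spectral_norm_ge0 (W - n%:R^-1 *: const_mx 1).
have c30 : 0 <= c3 by rewrite !addr_ge0// mulr_ge0.
have c10 : 0 <= c1 by rewrite addr_ge0// !mulr_ge0.
have tel : \sum_(1 <= t < T.+1) (t.-1%:R * V t - t%:R * V t.+1) <= 0.
  suff -> : \sum_(1 <= t < T.+1) (t.-1%:R * V t - t%:R * V t.+1) = - (T%:R * V T.+1).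
    rewrite oppr_le0 mulr_ge0// mulr_ge0// sumr_ge0// => k _; exact: sqr_ge0.
  elim: T => [|T IH]; first by rewrite big_geq// mul0r oppr0.
  by rewrite big_nat_recr//= IH; ring.
pose B := \sum_(1 <= t < T.+1) (1 + q t) / (alpha * t%:R).
have B0 : 0 <= B.
  rewrite /B sumr_ge0// => t _; apply: divr_ge0; last by rewrite mulr_ge0// ltW.
  by rewrite addr_ge0// mulr_ge0// sumr_ge0// => k _; exact: sqr_ge0.
have sd : \sum_(1 <= t < T.+1) delta t <= B / (1 - rho).
  by rewrite ler_pdivlMr// mulrC sum_delta.
have BB : B <= B / (1 - rho) by rewrite ler_pdivlMr// ler_piMr// gerBl.
have : \sum_(1 <= t < T.+1) S t / 4 <= \sum_(1 <= t < T.+1)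
  (alpha / 4 * (t.-1%:R * V t - t%:R * V t.+1) + Lyap t +
    c3 * delta t + c1 * ((1 + q t) / (alpha * t%:R))).
  by rewrite !big_seq; apply: ler_sum => t; rewrite mem_index_iota => /andP[t1 _]; exact: step.
have -> : \sum_(1 <= t < T.+1) S t / 4 = 4^-1 * \sum_(1 <= t < T.+1) S t.
  by rewrite mulr_sumr; apply: eq_bigr => t _; rewrite mulrC.
have -> : \sum_(1 <= t < T.+1)
    (alpha / 4 * (t.-1%:R * V t - t%:R * V t.+1) + Lyap t +
      c3 * delta t + c1 * ((1 + q t) / (alpha * t%:R))) =
    alpha / 4 * (\sum_(1 <= t < T.+1) (t.-1%:R * V t - t%:R * V t.+1)) +
    \sum_(1 <= t < T.+1) Lyap t + c3 * (\sum_(1 <= t < T.+1) delta t) + c1 * B.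
  by rewrite /B !mulr_sumr -!big_split.
have -> c : \sum_(1 <= t < T.+1) (4 * Lyap t + c * ((1 + q t) / t%:R)) =
    4 * (\sum_(1 <= t < T.+1) Lyap t) +
    c * \sum_(1 <= t < T.+1) (1 + q t) / t%:R.
  by rewrite !mulr_sumr -!big_split.
have -> : \sum_(1 <= t < T.+1) (1 + q t) / t%:R = alpha * B.
  rewrite /B mulr_sumr; apply: eq_bigr => t _.
  by rewrite invfM mulrCA (mulrA alpha) divff ?mul1r// gt_eqF.
have -> : 4 * (c1 + c3) / (alpha * (1 - rho)) * (alpha * B) =
    4 * (c1 * (B / (1 - rho)) + c3 * (B / (1 - rho))).
  by field; rewrite !gt_eqF.
have e1 := ler_wpM2l c30 sd; have e2 := ler_wpM2l c10 BB.
have e3 : alpha / 4 * \sum_(1 <= t < T.+1) (t.-1%:R * V t - t%:R * V t.+1) <= 0.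
  by rewrite mulr_ge0_le0// divr_ge0// ltW.
move: e1 e2 e3; move: (c3 * (B / _)) (c1 * (B / _)) (c3 * _) (c1 * B).
move: (alpha / 4 * _) (\sum_(1 <= t < T.+1) Lyap t) (\sum_(1 <= t < T.+1) S t).
by move=> *; lra.
Qed.

Lemma gap_time_average_le T : (0 < T)%N ->
  T%:R * (F (T%:R^-1 *: \sum_(1 <= t < T.+1) xb t) - F xs) <=
  \sum_(1 <= t < T.+1) S t.
Proof.
move=> T0; rewrite !big_add1 !big_mkord mulrBr sumrB sumr_const card_ord.
rewrite -(mulr_natl (F xs)) lerD2r.
have := @strongly_convex_mean _ _ alpha F 'I_T (fun t => xb t.+1).
by rewrite card_ord; apply => //; exact: ltW.
Qed.

(** By convexity the gradients at both ends bound the gap from both sides. This yields integrability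
    as well as the bounded branch of the minimum. *)
Lemma gap_time_average_bounded T : (0 < T)%N ->
  `|F (T%:R^-1 *: \sum_(1 <= t < T.+1) xb t) - F xs| <= (M + Lbar * D) * D.
Proof.
move=> T0; set y := T%:R^-1 *: _.
have yD : enorm (y - xs) <= D.
  have -> : y - xs = T%:R^-1 *: \sum_(1 <= t < T.+1) (xb t - xs).
    rewrite sumrB sumr_const_nat subn1 /= -(scaler_nat T xs) scalerBr scalerA.
    by rewrite mulVf ?scale1r// pnatr_eq0 -lt0n.
  rewrite enormZ ger0_norm ?invr_ge0// ler_pdivrMl ?ltr0n//.
  rewrite (le_trans (ler_enorm_sum _ _))// (@le_trans _ _ (\sum_(1 <= t < T.+1) D))//.
    rewrite !big_seq; apply: ler_sum => t; rewrite mem_index_iota => /andP[t1 _].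
    exact: xb_le.
  by rewrite sumr_const_nat subn1/= mulr_natl.
have gs : enorm (grad F xs) <= M.
  rewrite grad_average; last by move=> i z'; have [] := sf i.
  rewrite enormZ ger0_norm// (@le_trans _ _ (mean (fun k => enorm (grad (f k) xs))))//.
    by rewrite ler_wpM2l// ler_enorm_sum.
  by rewrite -[leRHS]mean_cst; exact: mean_le.
have gy : enorm (grad F y) <= M + Lbar * D.
  rewrite -(subrK (grad F xs) (grad F y)) (le_trans (ler_enormD _ _))//.
  rewrite addrC lerD//; have [_ /(_ y xs)] := sF; move/le_trans; apply.
  by rewrite ler_wpM2l.
have h1 := strongly_convex_ge y xs (ltW alpha0) cF.
have h2 := strongly_convex_ge xs y (ltW alpha0) cF.
rewrite -(opprB y) edotNr in h2.
have h3 := edot_le (grad F y) (y - xs); have h4 := edot_ge (grad F xs) (y - xs).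
have h5 : enorm (grad F y) * enorm (y - xs) <= (M + Lbar * D) * D.
  by rewrite ler_pM ?enorm_ge0.
have h6 : enorm (grad F xs) * enorm (y - xs) <= (M + Lbar * D) * D.
  by rewrite ler_pM ?enorm_ge0// (le_trans gs)// lerDl mulr_ge0.
rewrite ler_norml; apply/andP; split; lra.
Qed.

End regret.

(** * Measurability in a vector argument, and independence *)

Section measurability.
Context {R : realType} {d : nat} {dT : measure_display} {T : measurableType dT}.

(** Rounding to a grid leaves countably many values, so [F] may be any function: preimages are
    countable unions of finite intersections of half-open intervals. *)
Lemma measurable_grid (X : 'I_d -> T -> R) (c : R) (F : {ffun 'I_d -> int} -> R) :
  0 < c -> (forall j, measurable_fun setT (X j)) ->
  measurable_fun setT (fun w => F [ffun j => Num.floor (X j w * c)]).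
Proof.
move=> c0 mX _ B mB; rewrite setTI.
have -> : (fun w => F [ffun j => Num.floor (X j w * c)]) @^-1` B =
    \bigcup_(z : {ffun 'I_d -> int}) (if F z \in B then
      \bigcap_(j in [set: 'I_d]) (X j @^-1` `[(z j)%:~R / c, ((z j)%:~R + 1) / c[)
      else set0).
  apply/seteqP; split => [w /= Bw|w [z _]].
    exists [ffun j => Num.floor (X j w * c)] => //=; rewrite mem_set//.
    move=> j _ /=; rewrite in_itv/= ler_pdivrMr// ltr_pdivlMr//.
    by have := floor_itv (X j w * c); rewrite ffunE intrD1.
  case: ifPn => //; rewrite inE => Bz zw.
  rewrite /= (_ : [ffun j => _] = z)//.
  apply/ffunP => j; rewrite ffunE; apply/floor_def.
  have := zw j I; rewrite /= in_itv/= ler_pdivrMr// ltr_pdivlMr//.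
  by rewrite intrD1.
apply: countable_bigcupT_measurable => [|z]; first exact: countableP.
case: ifPn => // _; apply: fin_bigcap_measurable => [|j _]; first exact: finite_finset.
by rewrite -[X in measurable X]setTI; apply: mX => //; exact: measurable_itv.
Qed.

(** By continuity [F] is the pointwise limit of its values on ever finer grids. *)
Lemma measurable_continuous_rV (F : 'rV[R]_d -> R) (X : 'I_d -> T -> R) :
  continuous F -> (forall j, measurable_fun setT (X j)) ->
  measurable_fun setT (fun w => F (\row_j X j w)).
Proof.
move=> cF mX.
pose q (m : nat) (z : {ffun 'I_d -> int}) : 'rV[R]_d := \row_j ((z j)%:~R / m.+1%:R).
pose h m w := F (q m [ffun j => Num.floor (X j w * m.+1%:R)]).
apply: (@measurable_fun_cvg _ _ _ _ h) => [m|w _].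
  exact: (@measurable_grid X m.+1%:R (F \o q m)).
apply: continuous_cvg; first exact: cF.
apply/cvgrPdist_le => e e0; near=> m.
rewrite [leLHS]mx_normrE; apply: bigmax_le => [|[i j] _ /=]; first exact: ltW.
rewrite !mxE ffunE; set u := X j w.
have m0 : 0 < m.+1%:R :> R by [].
have := floor_itv (u * m.+1%:R); rewrite intrD1 -ler_pdivrMr// -ltr_pdivlMr//.
rewrite mulrDl mul1r => /andP[h1 h2].
rewrite ger0_norm ?subr_ge0// lerBlDl (le_trans (ltW h2))// lerD2l ltW//.
near: m; exact: near_infty_natSinv_lt (PosNum e0).
Unshelve. all: by end_near. Qed.

Lemma measurable_lipschitz_rV (F : 'rV[R]_d -> R) (c : R) (X : 'I_d -> T -> R) :
  (forall x y, `|F x - F y| <= c * enorm (x - y)) ->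
  (forall j, measurable_fun setT (X j)) ->
  measurable_fun setT (fun w => F (\row_j X j w)).
Proof.
by move=> Fc; apply: measurable_continuous_rV; exact: enorm_lipschitz_continuous Fc.
Qed.

End measurability.

Section independence.
Context {R : realType} {d d1 d2 : measure_display} {T : measurableType d}
  {T1 : measurableType d1} {T2 : measurableType d2}.
Variables (P : probability T R) (X : {mfun T >-> T1}) (Y : {mfun T >-> T2}).
Local Open Scope ereal_scope.

Hypothesis XY_indep : forall A B, measurable A -> measurable B ->
  P (X @^-1` A `&` Y @^-1` B) = P (X @^-1` A) * P (Y @^-1` B).

Let mXY : measurable_fun setT (fun w => (X w, Y w)).
Proof. exact: measurable_fun_pair. Qed.

Let XY : {mfun T >-> (T1 * T2)%type} :=
  HB.pack (fun w => (X w, Y w)) (isMeasurableFun.Build _ _ _ _ _ mXY).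

Let distrXY A : measurable A ->
  distribution P XY A = (distribution P X \x distribution P Y) A.
Proof. by move=> mA; apply/esym/product_measure_unique. Qed.

Lemma ge0_integral_independent (f : T1 * T2 -> \bar R) :
  measurable_fun setT f -> (forall z, 0 <= f z) ->
  \int[P]_w f (X w, Y w) = \int[P]_w \int[distribution P Y]_y f (X w, y).
Proof.
move=> mf f0.
transitivity (\int[distribution P XY]_z f z).
  by rewrite ge0_integral_distribution.
rewrite (eq_measure_integral (distribution P X \x distribution P Y)%E); last first.
  by move=> A mA _; exact: distrXY.
rewrite fubini_tonelli1// ge0_integral_distribution//.
- exact: measurable_fun_fubini_tonelli_F.
- by move=> y; exact: integral_ge0.
Qed.

(** Plays the part of a conditional expectation: a bound on the inner integral for every frozen [x]
    bounds the whole. Fubini for signed [f] requires integrability, which is carried from [P] to the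
    product law. *)
Lemma integral_independent_le (f : T1 * T2 -> \bar R) (c : R) :
  measurable_fun setT f -> P.-integrable setT (fun w => f (X w, Y w)) ->
  (forall x, \int[distribution P Y]_y f (x, y) <= c%:E) ->
  \int[P]_w f (X w, Y w) <= c%:E.
Proof.
move=> mf If fc.
have I' : (distribution P XY).-integrable setT f.
  by apply: integrable_pushforward.
have If' : (distribution P X \x distribution P Y).-integrable setT f.
  apply/integrableP; split=> //.
  rewrite (eq_measure_integral (distribution P XY)); last first.
    by move=> A mA _; exact/esym/distrXY.
  by have /integrableP[] := I'.
rewrite (_ : \int[P]_w f (X w, Y w) = \int[distribution P XY]_z f z); last first.
  by rewrite integral_distribution.
rewrite (eq_measure_integral (distribution P X \x distribution P Y)%E); last first.
  by move=> A mA _; exact: distrXY.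
rewrite -integral12_prod_meas1//.
have -> : c%:E = \int[distribution P X]_x c%:E.
  by rewrite integral_cst//= -[X in _ * X]/(distribution P X setT) probability_setT mule1.
apply: le_integral => //.
- exact: integrable_fubini_F.
- exact/finite_measure_integrable_cst.
- by move=> x _; exact: fc.
Qed.

End independence.

(** * Kernel moments under the uniform law, and the bias they leave *)

Section uniform_kernel.
Context {R : realType}.
Local Notation U := (uniform_prob (@ltrN11 R)).
Local Notation mu := (@lebesgue_measure R).
Local Notation I := (`[-1, 1]%classic : set R).

(* [uniform_prob] lives on [measurableTypeR R], whose display is not that of [R]. *)
Lemma integral_uniform_law (m : {measure set R -> \bar R}) (f : R -> \bar R) :
  (forall B : set R, measurable B -> m B = U B) ->
  measurable_fun setT f -> U.-integrable setT f ->
  (\int[m]_u f u = \int[U]_u f u)%E.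
Proof.
move=> mU mf If; pose idTR : measurableTypeR R -> R := idfun.
have midTR : measurable_fun setT idTR by move=> _ B mB; rewrite setTI.
transitivity (\int[pushforward U idTR]_u f u)%E.
  by apply: eq_measure_integral => B mB _; rewrite mU.
by rewrite integral_pushforward.
Qed.

Lemma integrable_uniformN11 (f : R -> R) : measurable_fun setT f ->
  mu.-integrable I (EFin \o f) -> U.-integrable setT (EFin \o f).
Proof.
move=> mf /integrableP[_ If]; apply/integrableP; split.
  exact/measurable_EFinP.
rewrite integral_uniform//; last first.
  by apply/measurable_EFinP; exact: measurableT_comp.
by rewrite lte_mul_pinfty// lee_fin invr_ge0; lra.
Qed.

(** The factor is the density on [[-1, 1]]; positive and negative parts reduce the claim to
    nonnegative functions. *)
Lemma Rintegral_uniformN11 (f : R -> R) : measurable_fun setT f ->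
  mu.-integrable I (EFin \o f) ->
  \int[U]_u f u = 2^-1 * \int[mu]_(u in I) f u.
Proof.
move=> mf If.
have U2 (g : R -> R) : measurable_fun setT g -> (forall u, 0 <= g u) ->
    mu.-integrable I (EFin \o g) ->
    \int[U]_u g u = 2^-1 * \int[mu]_(u in I) g u.
  move=> mg g0 Ig; rewrite /Rintegral integral_uniform//; last first.
    exact/measurable_EFinP.
  have -> : (1 - -1 : R) = 2 by ring.
  by rewrite fineM// integrable_fin_num.
have mfp : measurable_fun setT f^\+ by exact: measurable_funrpos.
have mfn : measurable_fun setT f^\- by exact: measurable_funrneg.
have Ip : mu.-integrable I (EFin \o f^\+) by exact: integrable_funrpos.
have In : mu.-integrable I (EFin \o f^\-) by exact: integrable_funrneg.
have fE u : f u = f^\+ u - f^\- u by rewrite -[in LHS](funrposBneg f).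
have -> : \int[U]_u f u = \int[U]_u (f^\+ u - f^\- u).
  by apply: eq_Rintegral => u _.
rewrite RintegralB//; last 2 first.
  exact: integrable_uniformN11.
  exact: integrable_uniformN11.
rewrite !U2// -mulrBr -RintegralB//; congr (_ * _).
by apply: eq_Rintegral => u _; rewrite -fE.
Qed.

(** The truncation inside [grad_estimator]; it is measurable on the whole line. *)
Definition kernel0 (K : R -> R) (u : R) : R := if -1 <= u <= 1 then K u else 0.

Lemma kernel0E (K : R -> R) : kernel0 K = K \_ I.
Proof. by apply/funext => u; rewrite patchE/= mem_setE in_itv. Qed.

Section kernel.
Variables (beta : R) (K : R -> R).
Hypothesis hK : kernel_cond beta K.
Local Notation K0 := (kernel0 K).

Lemma measurable_kernel0 : measurable_fun setT K0.
Proof.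
have [mK _ _ _ _] := hK; rewrite kernel0E.
exact/(measurable_restrictT K (measurable_itv _)).
Qed.

Let K0E : {in I, K0 =1 K}.
Proof. by move=> u; rewrite inE/= in_itv/= /kernel0 => ->. Qed.

Lemma integrable_sqr_kernel : U.-integrable setT (EFin \o (fun u => K0 u ^+ 2)).
Proof.
apply: integrable_uniformN11; first by apply: measurable_funX; exact: measurable_kernel0.
have [mK _ _ _ K2] := hK.
apply: (@eq_integrable _ _ _ mu I _ (EFin \o (fun u => K u ^+ 2))) => //.
  by move=> u Iu /=; rewrite K0E.
apply/integrableP; split.
  by apply/measurable_EFinP; exact: measurable_funX.
by under eq_integral do rewrite /= ger0_norm ?sqr_ge0//.
Qed.

(** On [[-1, 1]], [|u ^ p * K u| <= |K u| <= 1 + K u ^ 2], so square integrability covers all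
    moments. *)
Let integrable_moment_lebesgue (p : nat) :
  mu.-integrable I (EFin \o (fun u => u ^+ p * K0 u)).
Proof.
have [mK _ _ _ K2] := hK.
have mK0 : measurable_fun I K0 by apply: measurable_funTS; exact: measurable_kernel0.
apply: (@le_integrable _ _ _ mu I _ _ (EFin \o (fun u => 1 + K0 u ^+ 2))) => //.
- by apply/measurable_EFinP; apply: measurable_funM => //; exact: measurable_funX.
- move=> u _ /=; rewrite lee_fin [leRHS]ger0_norm ?addr_ge0 ?sqr_ge0//.
  rewrite /kernel0; case: ifPn => [u1|_]; last by rewrite mulr0 normr0 expr0n addr0.
  rewrite normrM normrX (@le_trans _ _ `|K u|)//.
    by rewrite ler_piMl// exprn_ile1// ler_norml.
  by rewrite -[K u ^+ 2]real_normK ?num_real//; have := sqr_ge0 (`|K u| - 1); nra.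
- have -> : EFin \o (fun u => 1 + K0 u ^+ 2) =
      (cst 1%:E \+ (EFin \o (fun u => (K0 u ^+ 2)%R)))%E by apply/funext.
  apply: integrableD => //.
    apply: (@measurable_bounded_integrable _ _ _ mu (cst 1) I) => //.
      by rewrite /= lebesgue_measure_itv/= lte_fin ltrN11 -EFinB ltry.
    by exists 1; split => // x x1 u _ /=; rewrite normr1 ltW.
  apply: (@eq_integrable _ _ _ mu I _ (EFin \o (fun u => K u ^+ 2))) => //.
    by move=> u Iu /=; rewrite K0E.
  apply/integrableP; split.
    by apply/measurable_EFinP; exact: measurable_funX.
  by under eq_integral do rewrite /= ger0_norm ?sqr_ge0//.
Qed.

Lemma integrable_moment_kernel (p : nat) :
  U.-integrable setT (EFin \o (fun u => u ^+ p * K0 u)).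
Proof.
apply: (@integrable_uniformN11 (fun u => u ^+ p * K0 u)); last exact: integrable_moment_lebesgue.
by apply: measurable_funM; [exact: measurable_funX|exact: measurable_kernel0].
Qed.

Lemma moment_kernel (p : nat) : (p <= strict_floor beta)%N ->
  \int[U]_u (u ^+ p * K0 u) = (p == 1%N)%:R / 2.
Proof.
move=> pl; rewrite Rintegral_uniformN11//; last first.
  by apply: measurable_funM; [exact: measurable_funX|exact: measurable_kernel0].
rewrite mulrC; congr (_ * _).
have -> : \int[mu]_(u in I) (u ^+ p * K0 u) = \int[mu]_(u in I) (u ^+ p * K u).
  by apply: eq_Rintegral => u Iu; rewrite K0E.
have [_ K1 Kj _ _] := hK; rewrite /Rintegral.
have [->|p1] := eqVneq p 1%N; last by rewrite Kj.
by under eq_integral do rewrite expr1; rewrite K1.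
Qed.

Let mpow : measurable_fun setT (fun u : R => `|u| `^ beta).
Proof.
exact: (measurableT_comp (measurable_powR beta) (@normr_measurable R setT)).
Qed.

Lemma integrable_holder_kernel :
  U.-integrable setT (EFin \o (fun u => `|u| `^ beta * `|K0 u|)).
Proof.
apply: integrable_uniformN11.
  apply: measurable_funM => //; apply: measurableT_comp => //.
  exact: measurable_kernel0.
have [mK _ _ Kb _] := hK.
apply: (@eq_integrable _ _ _ mu I _ (EFin \o (fun u => `|u| `^ beta * `|K u|))) => //.
  by move=> u Iu /=; rewrite K0E.
apply/integrableP; split.
  apply/measurable_EFinP; apply: measurable_funM; first exact: measurable_funTS.
  exact: measurableT_comp.
by under eq_integral do rewrite /= ger0_norm ?mulr_ge0 ?powR_ge0//.
Qed.

End kernel.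
End uniform_kernel.

Lemma Rintegral_sum {dT} {T : measurableType dT} {R : realType}
    (m : {measure set T -> \bar R}) {I : Type} (s : seq I) (f : I -> T -> R) :
  (forall i, m.-integrable setT (EFin \o f i)) ->
  m.-integrable setT (EFin \o (fun u => \sum_(i <- s) f i u)) /\
  \int[m]_u (\sum_(i <- s) f i u) = \sum_(i <- s) \int[m]_u f i u.
Proof.
move=> If; elim: s => [|i s [IH1 IH2]].
  split.
    apply: (eq_integrable measurableT (cst 0%E)) => //; last exact: integrable0.
    by move=> u _ /=; rewrite big_nil.
  rewrite big_nil (@eq_Rintegral _ _ _ m setT (fun=> 0)) ?Rintegral_cst ?mul0r//.
  by move=> u _; rewrite big_nil.
split.
  apply: (eq_integrable measurableT ((EFin \o f i) \+ (EFin \o (fun u => (\sum_(i <- s) f i u)%R)))%E) => //.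
    by move=> u _ /=; rewrite big_cons.
  exact: integrableD.
rewrite big_cons/= -IH2 -RintegralD//.
by apply: eq_Rintegral => u _; rewrite big_cons.
Qed.

Section bias.
Context {R : realType} {d : nat} (beta L : R) (K : R -> R).
Hypotheses (beta2 : 2 <= beta) (hK : kernel_cond beta K).
Local Notation U := (uniform_prob (@ltrN11 R)).
Local Notation K0 := (kernel0 K).

(** The Taylor polynomial reaches degree 1, where the gradient sits. *)
Lemma strict_floor_gt0 : (0 < strict_floor beta)%N.
Proof.
have b0 : 0 < beta by rewrite (lt_le_trans _ beta2).
have /andP[_ h] := strict_floorP b0; rewrite lt0n; apply: contraTneq h => ->.
by rewrite -ltNge (lt_le_trans _ beta2)// ltr1n.
Qed.

Lemma kernel_bias (F : 'rV[R]_d -> R) (x : 'rV[R]_d) (j : 'I_d) (h c : R)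
    (phi := fun u => (2 * h)^-1 *
       (F (x + (h * u) *: delta_mx 0 j) - F (x - (h * u) *: delta_mx 0 j) + c) *
       K0 u) :
  holder_class beta L F -> continuous F -> 0 < h ->
  U.-integrable setT (EFin \o phi) /\
  `|\int[U]_u phi u - 2^-1 * partial j F x| <=
    L * h `^ (beta - 1) * \int[U]_u (`|u| `^ beta * `|K0 u|).
Proof.
move=> [_ FT] cF h0.
have [b [/(_ strict_floor_gt0) b1 bT]] := taylor_line (strict_floor beta) F x j.
set l := strict_floor beta in bT FT *.
have mK0 : measurable_fun setT K0 := measurable_kernel0 hK.
(* Even powers cancel in the symmetric difference, so [c] is all that degree 0 carries. *)
pose a p := (2 * h)^-1 * (b p * (h ^+ p - (- h) ^+ p) + (if p == 0%N then c else 0)).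
pose q u := \sum_(p < l.+1) a p * (u ^+ p * K0 u).
have qE u : q u = (2 * h)^-1 * (taylor l F x (x + (h * u) *: delta_mx 0 j) -
    taylor l F x (x - (h * u) *: delta_mx 0 j) + c) * K0 u.
  have cE : c = \sum_(p < l.+1) (if p == 0%N :> nat then c else 0) * u ^+ p.
    by rewrite big_ord_recl/= expr0 mulr1 big1 ?addr0// => i _; rewrite mul0r.
  rewrite -scaleNr !bT [X in _ + X]cE -sumrB -big_split/= mulr_sumr mulr_suml.
  apply: eq_bigr => p _; rewrite /a -[- (h * u)]mulNr !exprMn; ring.
have Im p : U.-integrable setT (EFin \o (fun u => u ^+ p * K0 u)).
  exact: (integrable_moment_kernel hK).
have Ia p : U.-integrable setT (EFin \o (fun u => a p * (u ^+ p * K0 u))).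
  exact: (integrableZl measurableT (a p) (Im p)).
have [Iq intq] := Rintegral_sum (index_enum 'I_l.+1) (fun p => Ia p).
have {}intq : \int[U]_u q u = 2^-1 * partial j F x.
  rewrite /q intq (bigD1 (Ordinal (strict_floor_gt0 : 1 < l.+1)%N))//=.
  rewrite big1 ?addr0 => [|p p1]; last first.
    rewrite RintegralZl// (moment_kernel hK) ?ltnS ?leq_ord//.
    by rewrite (_ : (p == 1 :> nat)%N = false) ?mul0r ?mulr0//; apply/negbTE.
  rewrite RintegralZl// (moment_kernel hK) ?strict_floor_gt0// eqxx.
  by rewrite /a/= b1; field; rewrite gt_eqF.
have mphi : measurable_fun setT phi.
  have mline (s : R) : measurable_fun setT (fun u => F (x + (s * u) *: delta_mx 0 j)).
    rewrite (_ : (fun u => _) = fun u => F (\row_i (x 0 i + s * u * (delta_mx 0 j : 'rV[R]_d) 0 i))).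
      apply: measurable_continuous_rV => // i.
      by apply: measurable_funD => //; apply: measurable_funM => //; exact: measurable_funM.
    by apply/funext => u; congr F; apply/rowP => i; rewrite !mxE.
  rewrite /phi; apply: measurable_funM => //; apply: measurable_funM => //.
  apply: measurable_funD => //; apply: measurable_funB; first exact: mline.
  by under eq_fun do rewrite -scaleNr -mulNr; exact: mline.
have mq : measurable_fun setT q by apply/measurable_EFinP; case/integrableP : Iq.
have IB := integrable_holder_kernel hK.
have hb : h `^ beta = h `^ (beta - 1) * h.
  have := @powRD R h (beta - 1) 1; rewrite subrK powRr1 ?(ltW h0)//.
  by rewrite [h == 0]gt_eqF//= implybT; exact.
have remle u : `|phi u - q u| <= L * h `^ (beta - 1) * (`|u| `^ beta * `|K0 u|).
  rewrite qE /phi -mulrBl normrM mulrA ler_wpM2r// -mulrBr normrM.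
  rewrite gtr0_norm ?invr_gt0 ?mulr_gt0// ler_pdivrMl ?mulr_gt0//.
  have T1 := FT x (x + (h * u) *: delta_mx 0 j).
  have T2 := FT x (x - (h * u) *: delta_mx 0 j).
  have n1 : enorm (x + (h * u) *: delta_mx 0 j - x) = h * `|u|.
    by rewrite addrC addKr enorm_delta normrM gtr0_norm.
  have n2 : enorm (x - (h * u) *: delta_mx 0 j - x) = h * `|u|.
    by rewrite addrC addKr -scaleNr enorm_delta normrN normrM gtr0_norm.
  have hu : (h * `|u|) `^ beta = h `^ (beta - 1) * h * `|u| `^ beta.
    by rewrite powRM ?(ltW h0)// hb.
  rewrite n1 hu in T1; rewrite n2 hu in T2.
  set A := F _ in T1 *; set B := F _ in T2 *.
  set A' := taylor _ _ _ _ in T1 *; set B' := taylor _ _ _ _ in T2 *.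
  have -> : A - B + c - (A' - B' + c) = (A - A') - (B - B') by ring.
  rewrite (le_trans (ler_normB _ _))// (le_trans (lerD T1 T2))//.
  by rewrite le_eqVlt; apply/orP; left; apply/eqP; ring.
have Irem : U.-integrable setT (EFin \o (fun u => phi u - q u)).
  apply: (@le_integrable _ _ _ U setT _ _
    (fun u => (L * h `^ (beta - 1))%:E * (EFin \o (fun u => (`|u| `^ beta * `|K0 u|)%R)) u)%E) => //.
  - by apply/measurable_EFinP; exact: measurable_funB.
  - by move=> u _ /=; rewrite lee_fin (le_trans (remle u))// ler_norm.
  - exact: integrableZl.
have Iphi : U.-integrable setT (EFin \o phi).
  rewrite (_ : EFin \o phi =
      ((EFin \o (fun u => (phi u - q u)%R)) \+ (EFin \o q))%E).
    exact: integrableD.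
  by apply/funext => u /=; rewrite -EFinD subrK.
split=> //; rewrite -intq -RintegralB// (le_trans (le_normr_Rintegral _ Irem))//.
rewrite -RintegralZl//; apply: le_Rintegral => //.
- exact: integrable_norm.
- exact: (integrableZl measurableT (L * h `^ (beta - 1)) IB).
Qed.

End bias.

(** * Second moment and bias of one estimator coordinate *)

Section estimator.
Context {R : realType} {d : nat} (K : R -> R).
Local Notation K0 := (kernel0 K).

Lemma grad_estimatorE (h : R) (F : 'rV[R]_d -> R) y u (xi xi' : 'I_d -> R) j :
  grad_estimator K h F y u xi xi' 0 j =
  (2 * h)^-1 * (F (y + (h * u) *: delta_mx 0 j) - F (y - (h * u) *: delta_mx 0 j) +
    (xi j - xi' j)) * K0 u.
Proof. by rewrite mxE /kernel0; congr (_ * _ * _); ring. Qed.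

Lemma measurable_grad_estimator {dT} {T : measurableType dT} (h : R)
    (F : 'rV[R]_d -> R) (y : T -> 'rV[R]_d) (u : T -> R) (xi xi' : 'I_d -> T -> R) j :
  measurable_fun setT K0 -> continuous F ->
  (forall i, measurable_fun setT (fun w => y w 0 i)) -> measurable_fun setT u ->
  measurable_fun setT (xi j) -> measurable_fun setT (xi' j) ->
  measurable_fun setT (fun w => grad_estimator K h F (y w) (u w)
    (fun i => xi i w) (fun i => xi' i w) 0 j).
Proof.
move=> mK cF my mu mxi mxi'.
under eq_fun do rewrite grad_estimatorE.
have mline (s : R) : measurable_fun setT (fun w => F (y w + (s * u w) *: delta_mx 0 j)).
  rewrite (_ : (fun w => _) = fun w => F (\row_i (y w 0 i + s * u w * (delta_mx 0 j : 'rV[R]_d) 0 i))).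
    apply: measurable_continuous_rV => // i.
    by apply: measurable_funD => //; apply: measurable_funM => //; exact: measurable_funM.
  by apply/funext => w; congr F; apply/rowP => i; rewrite !mxE.
apply: measurable_funM; last exact: measurableT_comp.
apply: measurable_funM => //; apply: measurable_funD; last exact: measurable_funB.
apply: measurable_funB; first exact: mline.
by under eq_fun do rewrite -scaleNr -mulNr; exact: mline.
Qed.

(** The difference of values is at most [2 h (M + Lbar)], so only the noise keeps the factor
    [h ^ (-2)]. The bound splits into [K0 u ^ 2] and a part free of [u], ready for independence. *)
Lemma sqr_grad_estimator_le (h M Lbar : R) (F : 'rV[R]_d -> R) y u
    (xi xi' : 'I_d -> R) j :
  0 < h <= 1 -> 0 <= Lbar -> smooth2 Lbar F -> `|partial j F y| <= M ->
  grad_estimator K h F y u xi xi' 0 j ^+ 2 <= K0 u ^+ 2 *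
    (3 * (M + Lbar) ^+ 2 + 3 / (2 * h) ^+ 2 * xi j ^+ 2 + 3 / (2 * h) ^+ 2 * xi' j ^+ 2).
Proof.
move=> /andP[h0 h1] L0 sF FM; rewrite grad_estimatorE /kernel0.
case: ifPn => [u1|_]; last by rewrite !mulr0 expr0n/= mul0r.
set D := _ - _; have hE : 0 < 2 * h by rewrite mulr_gt0.
have D1 : `|D| <= 2 * h * (M + Lbar).
  have hu : `|h * u| <= h by rewrite normrM gtr0_norm// ler_piMr ?ler_norml// ltW.
  apply: le_trans (smooth_coord_diff _ _ _ sF) _; apply: ler_pM.
  - by rewrite mulr_ge0.
  - by rewrite addr_ge0// mulr_ge0.
  - by rewrite ler_pM2l.
  - by rewrite lerD// ler_piMr// (le_trans hu).
have D2 : D ^+ 2 <= (2 * h) ^+ 2 * (M + Lbar) ^+ 2.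
  rewrite -exprMn -[D ^+ 2]real_normK ?num_real// ler_pXn2r ?nnegrE//.
  by rewrite (le_trans _ D1).
have S3 : (D + (xi j - xi' j)) ^+ 2 <= 3 * (D ^+ 2 + xi j ^+ 2 + xi' j ^+ 2).
  have := sqr_ge0 (D - xi j); have := sqr_ge0 (D + xi' j).
  have := sqr_ge0 (xi j + xi' j); lra.
have q0 : 0 < (2 * h) ^+ 2 by rewrite exprn_gt0.
rewrite [leLHS](_ : _ = K u ^+ 2 * (((2 * h) ^+ 2)^-1 * (D + (xi j - xi' j)) ^+ 2)); last first.
  by rewrite -exprVn -!exprMn; congr (_ ^+ 2); ring.
rewrite ler_wpM2l ?sqr_ge0// ler_pdivrMl// (le_trans S3)//.
move: ((2 * h) ^+ 2) q0 D2 => q q0 D2.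
have e (a : R) : q * (3 / q * a) = 3 * a by field; rewrite gt_eqF.
by have := e (xi j ^+ 2); have := e (xi' j ^+ 2); lra.
Qed.

End estimator.

Lemma ler_norm_1Dsqr {R : realType} (a : R) : `|a| <= 1 + a ^+ 2.
Proof.
by rewrite -[a ^+ 2]real_normK ?num_real//; have := sqr_ge0 (`|a| - 1); nra.
Qed.

(** AM-GM weighted so that the reserved [alpha / 8 * v ^ 2] pays for a bias of size [B]. *)
Lemma linear_le_quadratic {R : realType} (alpha a b v B : R) :
  0 < alpha -> `|b - a| <= B ->
  a * v - alpha / 8 * v ^+ 2 - v * b <= 2 / alpha * B ^+ 2.
Proof.
move=> alpha0 ba.
have h1 : (a - b) * v <= B * `|v|.
  by rewrite (le_trans (ler_norm _))// normrM ler_wpM2r// distrC.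
have h2 : B * `|v| <= alpha / 8 * v ^+ 2 + 2 / alpha * B ^+ 2.
  rewrite -[v ^+ 2]real_normK ?num_real// -subr_ge0.
  rewrite [X in 0 <= X](_ : _ = (8 * alpha)^-1 * (alpha * `|v| - 4 * B) ^+ 2).
    by rewrite mulr_ge0 ?sqr_ge0// invr_ge0 mulr_ge0// ltW.
  by field; rewrite gt_eqF.
lra.
Qed.

Section moments.
Context {R : realType} {d : nat} {dO : measure_display}
  {Omega : measurableType dO} (P : probability Omega R).
Variables (beta L Lbar sigma M D alpha h : R) (K : R -> R)
  (F : 'rV[R]_d -> R) (rho : {RV P >-> R}) (xi xi' : 'I_d -> {RV P >-> R})
  (y : Omega -> 'rV[R]_d) (xs : 'rV[R]_d) (S : set (Omega -> R)) (j : 'I_d).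
Local Notation U := (uniform_prob (@ltrN11 R)).
Local Notation K0 := (kernel0 K).
Hypotheses (beta2 : 2 <= beta) (hK : kernel_cond beta K).
Hypotheses (L0 : 0 <= L) (Lbar0 : 0 <= Lbar) (alpha0 : 0 < alpha).
Hypotheses (h01 : 0 < h <= 1).
Hypotheses (FH : holder_class beta L F) (sF : smooth2 Lbar F).
Hypotheses (yM : forall w, enorm (grad F (y w)) <= M)
  (yD : forall w, enorm (y w - xs) <= D).
Hypotheses (mS : forall X, S X -> measurable_fun setT X)
  (Sy : forall i, S (fun w => y w 0 i)) (Sxi : S (xi j)) (Sxi' : S (xi' j)).
Hypotheses (rhoU : forall B : set R, measurable B -> distribution P rho B = U B)
  (rho_indep : forall (A : set Omega) (B : set R), sigma_generated S A ->
    measurable B -> (P (A `&` rho @^-1` B) = P A * P (rho @^-1` B))%E).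
Hypotheses (xi2 : ('E_P[fun w => (xi j w ^+ 2)%R] <= (sigma ^+ 2)%:E)%E)
  (xi'2 : ('E_P[fun w => (xi' j w ^+ 2)%R] <= (sigma ^+ 2)%:E)%E).

Let g w := grad_estimator K h F (y w) (rho w) (fun i => xi i w) (fun i => xi' i w) 0 j.
Let kappa := \int[U]_u K0 u ^+ 2.
Let kappab := \int[U]_u (`|u| `^ beta * `|K0 u|).
Let h0 : 0 < h. Proof. by case/andP: h01. Qed.

(** Generators of the sigma-algebra of past and noise. The [X] below is the identity, seen as a
    random element of [Omega] with this smaller sigma-algebra, so [rho_indep] says that [X] and
    [rho] are independent. Here [rho] is the random scale, not a spectral norm. *)
Let G : set (set Omega) :=
  [set E | exists X (B : set R), [/\ S X, measurable B & E = X @^-1` B]].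
Let T' := g_sigma_algebraType G.

Let GM : G `<=` measurable.
Proof.
by move=> _ [X [B [SX mB ->]]]; rewrite -[X in measurable X]setTI; exact: mS.
Qed.

Let idG : Omega -> T' := id.

Let midG : measurable_fun setT idG.
Proof.
move=> _ A mA; rewrite setTI.
apply: (@smallest_sub _ (@sigma_algebra _ setT) G _ _ GM A mA).
exact: sigma_algebra_measurable.
Qed.

Let X : {mfun Omega >-> T'} :=
  HB.pack idG (isMeasurableFun.Build _ _ _ _ _ midG).

Let indep A B : measurable A -> measurable B ->
  P (X @^-1` A `&` rho @^-1` B) = (P (X @^-1` A) * P (rho @^-1` B))%E.
Proof. by move=> mA mB; exact: rho_indep. Qed.

Let mS' (Z : Omega -> R) : S Z -> measurable_fun setT (Z : T' -> R).
Proof.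
move=> SZ _ B mB; rewrite setTI; apply: sub_sigma_algebra.
by exists Z, B.
Qed.

Let cF : continuous F.
Proof. by move=> x; apply: differentiable_continuous; have [] := sF. Qed.

Let mK0 : measurable_fun setT K0 := measurable_kernel0 hK.

Let mg : measurable_fun setT g.
Proof.
by apply: measurable_grad_estimator => // i; exact: (mS (Sy i)).
Qed.

Let pM w : `|partial j F (y w)| <= M.
Proof. exact: le_trans (ler_partial_enorm _ _ _) (yM w). Qed.

Let c1 := 3 * (M + Lbar) ^+ 2.
Let c2 := 3 / (2 * h) ^+ 2.
Let Y w := c1 + c2 * xi j w ^+ 2 + c2 * xi' j w ^+ 2.

Let c10 : 0 <= c1. Proof. by rewrite mulr_ge0// sqr_ge0. Qed.
Let c20 : 0 <= c2. Proof. by rewrite divr_ge0// sqr_ge0. Qed.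
Let Y0 w : 0 <= Y w.
Proof. by rewrite !addr_ge0// mulr_ge0// sqr_ge0. Qed.

Let kappa0 : 0 <= kappa. Proof. by apply: Rintegral_ge0 => u _; exact: sqr_ge0. Qed.

Let kappaE : (\int[distribution P rho]_u (K0 u ^+ 2)%:E = kappa%:E)%E.
Proof.
rewrite (integral_uniform_law rhoU); last 2 first.
- by apply/measurable_EFinP; exact: measurable_funX.
- exact: integrable_sqr_kernel hK.
by rewrite fineK// integrable_fin_num//; exact: integrable_sqr_kernel hK.
Qed.

Let EY : (\int[P]_w (Y w)%:E <= (c1 + 2 * c2 * sigma ^+ 2)%:E)%E.
Proof.
have mx2 (Z : Omega -> R) : S Z -> measurable_fun setT (fun w => (Z w ^+ 2)%:E).
  by move=> SZ; apply/measurable_EFinP; apply: measurable_funX; exact: mS.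
have x2 (Z : {RV P >-> R}) : (forall w, 0 <= (c2 * Z w ^+ 2)).
  by move=> w; rewrite mulr_ge0// sqr_ge0.
have E2 (Z : {RV P >-> R}) : S Z -> ('E_P[fun w => (Z w ^+ 2)%R] <= (sigma ^+ 2)%:E)%E ->
    (\int[P]_w (c2 * Z w ^+ 2)%:E <= (c2 * sigma ^+ 2)%:E)%E.
  move=> SZ; rewrite unlock => h1.
  under eq_integral do rewrite EFinM.
  rewrite ge0_integralZl//; last 2 first.
  - exact: mx2.
  - by move=> w _; rewrite lee_fin sqr_ge0.
  have c20E : (0 <= c2%:E)%E by rewrite lee_fin.
  exact: (lee_wpmul2l c20E h1).
have mc2 (Z : Omega -> R) : S Z -> measurable_fun setT (fun w => (c2 * Z w ^+ 2)%:E).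
  by move=> SZ; apply/measurable_EFinP; apply: measurable_funM => //; apply: measurable_funX; exact: mS.
under eq_integral do rewrite 2!EFinD.
rewrite ge0_integralD//; last 4 first.
- by move=> w _; rewrite adde_ge0// lee_fin// x2.
- by apply: emeasurable_funD => //; exact: mc2.
- by move=> w _; rewrite lee_fin x2.
- exact: mc2.
rewrite ge0_integralD//; last 2 first.
- by move=> w _; rewrite lee_fin x2.
- exact: mc2.
rewrite integral_cst//= probability_setT mule1.
have -> : (c1 + 2 * c2 * sigma ^+ 2)%:E =
  (c1%:E + (c2 * sigma ^+ 2)%:E + (c2 * sigma ^+ 2)%:E)%E.
  by rewrite -!EFinD; congr EFin; ring.
by rewrite leeD// ?leeD// E2.
Qed.

(** The squared kernel value and [Y] are independent, so their means multiply; [h <= 1] brings the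
    smooth part under the common [h ^ (-2)]. *)
Lemma second_moment_grad_estimator :
  P.-integrable setT (EFin \o (fun w => g w ^+ 2)) /\
  \int[P]_w g w ^+ 2 <= kappa * (3 * ((M + Lbar) ^+ 2 + sigma ^+ 2)) / h ^+ 2.
Proof.
have I2 : (\int[P]_w (g w ^+ 2)%:E <= (kappa * (c1 + 2 * c2 * sigma ^+ 2))%:E)%E.
  pose f (z : T' * R) := (K0 z.2 ^+ 2 * Y z.1)%:E.
  have mY : measurable_fun setT (Y : T' -> R).
    apply: measurable_funD; last first.
      by apply: measurable_funM => //; apply: measurable_funX; exact: mS'.
    apply: measurable_funD => //.
    by apply: measurable_funM => //; apply: measurable_funX; exact: mS'.
  have mf : measurable_fun setT f.
    apply/measurable_EFinP; apply: measurable_funM.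
      by apply: measurable_funX; exact: measurableT_comp.
    exact: measurableT_comp.
  have f0 z : (0 <= f z)%E by rewrite lee_fin mulr_ge0// sqr_ge0.
  apply: (@le_trans _ _ (\int[P]_w f (X w, rho w)))%E.
    apply: ge0_le_integral => //.
    - by move=> w _; rewrite lee_fin sqr_ge0.
    - by apply/measurable_EFinP; exact: measurable_funX.
    - apply: (measurableT_comp mf).
      exact: measurable_fun_pair.
    - by move=> w _; rewrite lee_fin; apply: sqr_grad_estimator_le.
  rewrite (ge0_integral_independent indep mf f0).
  have inner w : (\int[distribution P rho]_u f (X w, u) = kappa%:E * (Y w)%:E)%E.
    transitivity (\int[distribution P rho]_u ((Y w)%:E * (K0 u ^+ 2)%:E))%E.
      by apply: eq_integral => u _; rewrite /f/= mulrC EFinM.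
    rewrite ge0_integralZl//; last 3 first.
    - by apply/measurable_EFinP; exact: measurable_funX.
    - by move=> u _; rewrite lee_fin sqr_ge0.
    - by rewrite lee_fin.
    by rewrite kappaE muleC.
  under eq_integral do rewrite inner.
  rewrite ge0_integralZl//; last 2 first.
  - by apply/measurable_EFinP; exact: (measurableT_comp mY midG).
  - by move=> w _; rewrite lee_fin.
  have kappa0E : (0 <= kappa%:E)%E by rewrite lee_fin.
  exact: (lee_wpmul2l kappa0E EY).
have Ig : P.-integrable setT (EFin \o (fun w => g w ^+ 2)).
  apply/integrableP; split; first by apply/measurable_EFinP; exact: measurable_funX.
  under eq_integral do rewrite /= ger0_norm ?sqr_ge0//.
  exact: le_lt_trans I2 (ltry _).
split=> //; rewrite -lee_fin /Rintegral fineK ?integrable_fin_num//.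
apply: (le_trans I2); rewrite lee_fin -[leRHS]mulrA ler_wpM2l// ler_pdivlMr ?exprn_gt0//.
have h2 : h ^+ 2 <= 1 by rewrite exprn_ile1// ?(ltW h0); case/andP: h01.
have -> : (c1 + 2 * c2 * sigma ^+ 2) * h ^+ 2 = c1 * h ^+ 2 + 3 / 2 * sigma ^+ 2.
  by rewrite /c2; field; rewrite gt_eqF.
have := ler_wpM2l c10 h2; have := sqr_ge0 sigma; rewrite /c1 => s0; lra.
Qed.

(** For a frozen outcome the integral over the random scale is that of [kernel_bias], with the noise
    difference as [c]; [linear_le_quadratic] then bounds it uniformly in the outcome. *)
Lemma bias_grad_estimator
    (psi := fun w => (2^-1 * partial j F (y w) - g w) * (y w 0 j - xs 0 j) -
      alpha / 8 * (y w 0 j - xs 0 j) ^+ 2) :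
  P.-integrable setT (EFin \o psi) /\
  \int[P]_w psi w <= 2 / alpha * (L * h `^ (beta - 1) * kappab) ^+ 2.
Proof.
have D0 (w : Omega) : 0 <= D by exact: le_trans (enorm_ge0 _) (yD w).
have vD w : `|y w 0 j - xs 0 j| <= D.
  have := ler_coord_enorm (y w - xs) j; rewrite !mxE => h1.
  exact: le_trans h1 (yD w).
have pc : continuous (partial j F) := smooth2_grad_continuous sF.
have mpart (dT : measure_display) (T : measurableType dT) (z : T -> 'rV[R]_d) :
    (forall i, measurable_fun setT (fun w => z w 0 i)) ->
    measurable_fun setT (fun w => partial j F (z w)).
  move=> mz; rewrite (_ : (fun w => _) = (fun w => partial j F (\row_i z w 0 i))).
    exact: measurable_continuous_rV.
  by apply/funext => w; congr (partial j F _); apply/rowP => i; rewrite mxE.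
pose psi' (z : T' * R) := (2^-1 * partial j F (y z.1) -
  grad_estimator K h F (y z.1) z.2 (fun i => xi i z.1) (fun i => xi' i z.1) 0 j) *
  (y z.1 0 j - xs 0 j) - alpha / 8 * (y z.1 0 j - xs 0 j) ^+ 2.
have mfst (Z : Omega -> R) : S Z -> measurable_fun setT (fun z : T' * R => Z z.1).
  by move=> SZ; exact: (measurableT_comp (mS' SZ)).
have mpsi' : measurable_fun setT psi'.
  have mv : measurable_fun setT (fun z : T' * R => y z.1 0 j - xs 0 j).
    by apply: measurable_funB => //; exact: (mfst (fun w => y w 0 j)).
  apply: measurable_funB; last first.
    by apply: measurable_funM => //; exact: measurable_funX.
  apply: measurable_funM => //; apply: measurable_funB.
    apply: measurable_funM => //; apply: (mpart _ _ (fun z : T' * R => y z.1)).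
    by move=> i; exact: (mfst (fun w => y w 0 i)).
  apply: (@measurable_grad_estimator R d K _ (T' * R)%type h F
    (fun z => y z.1) snd (fun i z => xi i z.1) (fun i z => xi' i z.1) j).
  - exact: mK0.
  - exact: cF.
  - by move=> i; exact: (mfst (fun w => y w 0 i)).
  - exact: measurable_snd.
  - exact: (mfst (xi j)).
  - exact: (mfst (xi' j)).
have mpsi : measurable_fun setT psi.
  have mXr : measurable_fun setT (fun w => (X w, rho w)) by exact: measurable_fun_pair.
  exact: (measurableT_comp mpsi' mXr).
have [Ig _] := second_moment_grad_estimator.
have Ipsi : P.-integrable setT (EFin \o psi).
  (* The dominating function comes from [|g| <= 1 + g ^ 2], reducing integrability to the second
     moment. *)
  apply: (@le_integrable _ _ _ P setT _ _
    (EFin \o (fun w => (M + 1 + g w ^+ 2) * D + alpha * D ^+ 2))) => //.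
  - exact/measurable_EFinP.
  - move=> w _ /=; rewrite lee_fin.
    have M0 : 0 <= M by exact: le_trans (normr_ge0 _) (pM w).
    have v2 : (y w 0 j - xs 0 j) ^+ 2 <= D ^+ 2.
      by rewrite -[leLHS]real_normK ?num_real// ler_pXn2r ?nnegrE ?(D0 w).
    rewrite [leRHS]ger0_norm; last first.
      have D0' := D0 w; apply: addr_ge0; apply: mulr_ge0 => //.
      - by rewrite addr_ge0 ?sqr_ge0// addr_ge0.
      - exact: ltW.
      - exact: sqr_ge0.
    rewrite /psi (le_trans (ler_normB _ _))//; apply: lerD.
      rewrite normrM; apply: ler_pM => //.
      apply: le_trans (ler_normB _ _) _; rewrite -addrA; apply: lerD.
        rewrite normrM gtr0_norm ?invr_gt0// ler_pdivrMl// (le_trans (pM w))//.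
        by rewrite ler_peMl// ler1n.
      exact: ler_norm_1Dsqr.
    rewrite normrM gtr0_norm ?divr_gt0// ger0_norm ?sqr_ge0//; apply: ler_pM => //.
    - by rewrite divr_ge0// ltW.
    - exact: sqr_ge0.
    - by rewrite ler_pdivrMr// ler_peMr ?ler1n// ltW.
  - rewrite (_ : EFin \o _ = (fun w => D%:E * (g w ^+ 2)%:E +
      ((M + 1) * D + alpha * D ^+ 2)%:E)%E).
      apply: integrableD => //; first exact: (integrableZl measurableT D Ig).
      exact: finite_measure_integrable_cst.
    by apply/funext => w /=; rewrite -EFinM -EFinD; congr EFin; ring.
split=> //; rewrite -lee_fin /Rintegral fineK ?integrable_fin_num//.
apply: (integral_independent_le (f := EFin \o psi') indep) => //.
  exact/measurable_EFinP.
move=> w.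
have [Iphi] := kernel_bias beta2 hK (y w) j (xi j w - xi' j w) FH cF h0.
set phi := fun u => _ in Iphi *; set b := \int[U]_u phi u; rewrite -/kappab.
set v := y w 0 j - xs 0 j; set a := 2^-1 * partial j F (y w) => ba.
have psiE u : psi' (w, u) = (a * v - alpha / 8 * v ^+ 2) - v * phi u.
  by rewrite /psi'/= grad_estimatorE -/a -/v -/(phi u); ring.
have Iv : U.-integrable setT (EFin \o (fun u => v * phi u)).
  exact: (integrableZl measurableT v Iphi).
have Ic : U.-integrable setT (EFin \o cst (a * v - alpha / 8 * v ^+ 2)).
  exact: finite_measure_integrable_cst.
have Icv : U.-integrable setT
    (EFin \o (fun u => (a * v - alpha / 8 * v ^+ 2) - v * phi u)).
  exact: (integrableB measurableT Ic Iv).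
have -> : (\int[distribution P rho]_u (EFin \o psi') (w, u) =
    (\int[U]_u ((a * v - alpha / 8 * v ^+ 2) - v * phi u))%R%:E)%E.
  rewrite /Rintegral fineK ?integrable_fin_num//.
  rewrite -(integral_uniform_law rhoU)//; last by case/integrableP : Icv.
  by apply: eq_integral => u _; rewrite /= psiE.
rewrite lee_fin RintegralB// RintegralZl// Rintegral_cst//.
have U1 : U setT = 1%:E := probability_setT U.
rewrite [fine _](_ : _ = 1) ?mulr1 -/b; last by rewrite -[RHS]/(fine 1%:E) -U1.
exact: linear_le_quadratic.
Qed.

End moments.

(** * Measurability and boundedness of the iterates; bounds in expectation *)

Section iterates.
Context {R : realType} {n d : nat} {dO : measure_display}
  {Omega : measurableType dO}.
Variables (Theta : set 'rV[R]_d) (W : 'M[R]_n) (f : 'I_n -> 'rV[R]_d -> R)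
  (K : R -> R) (eta h : nat -> R) (r : 'I_n -> nat -> Omega -> R)
  (xi xi' : 'I_n -> nat -> 'I_d -> Omega -> R) (x1 : 'rV[R]_d)
  (x : 'I_n -> nat -> Omega -> 'rV[R]_d).
Hypotheses (Theta0 : Theta !=set0) (cTheta : compact Theta)
  (cvTheta : convex_set (Theta : set (convex_lmodType 'rV[R]_d))).
Hypothesis zo : zo_iterates Theta W f K eta h r xi xi' x1 x.

(** Induction on time: each coordinate of the projection is 1-Lipschitz, hence preserves
    measurability. *)
Lemma measurable_iterates : measurable_fun setT (kernel0 K) ->
  (forall k, continuous (f k)) ->
  (forall k t, measurable_fun setT (r k t)) ->
  (forall k t j, measurable_fun setT (xi k t j)) ->
  (forall k t j, measurable_fun setT (xi' k t j)) ->
  forall t k j, (1 <= t)%N -> measurable_fun setT (fun w => x k t w 0 j).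
Proof.
move=> mK cf mr mxi mxi'; have [xinit xstep] := zo.
elim=> [//|[_ k j _|t IH k j _]].
  rewrite (_ : (fun w => _) = cst (x1 0 j)); first exact: measurable_cst.
  by apply/funext => w; rewrite xinit.
under eq_fun do rewrite xstep// summxE.
apply: measurable_sum => l.
pose X i w := x l t.+1 w 0 i - eta t.+1 * grad_estimator K (h t.+1) (f l)
  (x l t.+1 w) (r l t.+1 w) (fun i => xi l t.+1 i w) (fun i => xi' l t.+1 i w) 0 i.
rewrite (_ : (fun w => _) = (fun w => W k l * eproj Theta (\row_i X i w) 0 j)).
  apply: measurable_funM => //.
  apply: (@measurable_lipschitz_rV _ _ _ _ (fun v => eproj Theta v 0 j) 1 X) => [v v'|i].
    rewrite mul1r; apply: le_trans (eproj_nonexpansive v v' Theta0 cTheta cvTheta).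
    by have := ler_coord_enorm (eproj Theta v - eproj Theta v') j; rewrite !mxE.
  apply: measurable_funB; first exact: IH.
  apply: measurable_funM => //; apply: measurable_grad_estimator => //.
  by move=> i'; exact: IH.
apply/funext => w; rewrite mxE; congr (_ * eproj Theta _ 0 j).
by apply/rowP => i; rewrite !mxE /X !mxE.
Qed.

(** After the first step every iterate is a convex combination of points of [Theta], so only time 1
    calls on the distance from [x1]. *)
Lemma iterates_bounded D xs w : (0 < n)%N -> doubly_stochastic W -> Theta xs ->
  ediam Theta <= D -> enorm (x1 - xs) <= D ->
  forall t k, (1 <= t)%N -> enorm (x k t w - xs) <= D.
Proof.
move=> n0 [W0 W1 _] Txs TD x1D; have [xinit xstep] := zo.
case=> [//|[k _|t k _]]; first by rewrite xinit.
pose z l := eproj Theta (x l t.+1 w - eta t.+1 *: grad_estimator K (h t.+1) (f l)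
  (x l t.+1 w) (r l t.+1 w) (fun j => xi l t.+1 j w) (fun j => xi' l t.+1 j w)).
have -> : x k t.+2 w = \sum_l W k l *: z l by rewrite xstep.
have -> : \sum_l W k l *: z l - xs = \sum_l W k l *: (z l - xs).
  under [RHS]eq_bigr do rewrite scalerBr.
  by rewrite sumrB -scaler_suml W1 scale1r.
rewrite (le_trans (ler_enorm_sum _ _))//.
apply: (@le_trans _ _ (\sum_l W k l * D)); last by rewrite -mulr_suml W1 mul1r.
apply: ler_sum => l _; rewrite enormZ ger0_norm// ler_wpM2l//.
exact: le_trans (enorm_le_ediam cTheta (eprojP _ Theta0 cTheta).1 Txs) TD.
Qed.

End iterates.

Section expect_le.
Context {d : measure_display} {T : measurableType d} {R : realType}
  (P : probability T R).

(** Integrability is included because the real-valued integral of a nonintegrable function may be a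
    default value, for which a bound would be void. *)
Definition expect_le (f : T -> R) (c : R) :=
  P.-integrable setT (EFin \o f) /\ \int[P]_w f w <= c.

Lemma expect_le_sum {I : Type} (s : seq I) (f : I -> T -> R) (c : I -> R) :
  (forall i, expect_le (f i) (c i)) ->
  expect_le (fun w => \sum_(i <- s) f i w) (\sum_(i <- s) c i).
Proof.
move=> fc; have [I1 I2] := Rintegral_sum s (fun i => (fc i).1).
by split=> //; rewrite I2; apply: ler_sum => i _; have [] := fc i.
Qed.

Lemma expect_le_cst c : expect_le (fun=> c) c.
Proof.
split; first exact: finite_measure_integrable_cst.
by rewrite Rintegral_cst//= probability_setT mulr1.
Qed.

Lemma expect_leD f g a b : expect_le f a -> expect_le g b ->
  expect_le (fun w => f w + g w) (a + b).
Proof.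
move=> [If fa] [Ig gb]; split; first exact: (integrableD measurableT If Ig).
by rewrite RintegralD// lerD.
Qed.

Lemma expect_leZ k f a : 0 <= k -> expect_le f a ->
  expect_le (fun w => k * f w) (k * a).
Proof.
move=> k0 [If fa]; split; first exact: (integrableZl measurableT k If).
by rewrite RintegralZl// ler_wpM2l.
Qed.

Lemma expectation_le_bounded (Z H : T -> R) (B C : R) : measurable_fun setT Z ->
  (forall w, `|Z w| <= B) -> (forall w, Z w <= H w) -> expect_le H C ->
  ('E_P[Z] <= C%:E)%E.
Proof.
move=> mZ ZB ZH [IH HC].
have IZ : P.-integrable setT (EFin \o Z).
  apply: measurable_bounded_integrable => //.
    by rewrite -[X in (X < _)%E]/(P setT) probability_setT ltry.
  exists B; split; first exact: num_real.
  by move=> b Bb w _ /=; rewrite (le_trans (ZB w))// ltW.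
rewrite unlock; apply: (@le_trans _ _ (\int[P]_w Z w)%R%:E).
  by rewrite /Rintegral fineK// integrable_fin_num.
by rewrite lee_fin (le_trans _ HC)//; apply: le_Rintegral.
Qed.

End expect_le.

(** * Summation of the rate and expected regret *)

Section power_sums.
Context {R : realType}.

(* Weighted AM-GM gives [(1 - 1 / t) `^ s <= 1 - s / t] for [s = 1 / beta], whose
   telescoping bounds the sum. *)
Lemma sum_powR_le (beta : R) (T : nat) : 1 < beta ->
  \sum_(1 <= t < T.+1) t%:R `^ (beta^-1 - 1) <= beta * T%:R `^ beta^-1.
Proof.
move=> b1; have b0 : 0 < beta by apply: lt_trans b1.
elim: T => [|T IH]; first by rewrite big_geq// mulr_ge0 ?powR_ge0// ltW.
rewrite big_nat_recr//=; apply: (le_trans (lerD IH (lexx _))).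
set t : R := T.+1%:R; have t0 : 0 < t by [].
set a := T%:R : R; have aE : a = t - 1 by rewrite /a /t -[T.+1]addn1 natrD addrK.
have a0 : 0 <= a by [].
have tE : t `^ beta^-1 = t * t `^ (beta^-1 - 1).
  have := @powRD R t 1 (beta^-1 - 1).
  by rewrite addrCA subrr addr0 powRr1 ?(ltW t0)// [t == 0]gt_eqF//= implybT; exact.
have h1 : (a / t) `^ beta^-1 <= a / t / beta + (1 - beta^-1).
  have q0 : 0 < 1 - beta^-1 by rewrite subr_gt0 invf_lt1.
  have := @conjugate_powR R ((a / t) `^ beta^-1) 1 beta (1 - beta^-1)^-1.
  rewrite mulr1 -powRrM mulVf ?gt_eqF// powR1 invrK mul1r powRr1 ?divr_ge0 ?(ltW t0)//.
  by apply => //; [exact: powR_ge0|rewrite invr_gt0|rewrite addrC subrK].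
have h2 : a `^ beta^-1 = t `^ beta^-1 * (a / t) `^ beta^-1.
  by rewrite -powRM ?divr_ge0 ?(ltW t0)// mulrCA divff ?mulr1// gt_eqF.
have h3 : beta * a `^ beta^-1 <= beta * (t `^ beta^-1 * (a / t / beta + (1 - beta^-1))).
  by rewrite h2 ler_wpM2l ?(ltW b0)// ler_wpM2l ?powR_ge0.
apply: (le_trans (lerD h3 (lexx _))).
rewrite tE aE le_eqVlt; apply/orP; left; apply/eqP; field.
by rewrite !gt_eqF.
Qed.

End power_sums.

Section expected_regret.
Context {R : realType} {n d : nat} {dO : measure_display}
  {Omega : measurableType dO} (P : probability Omega R).
Variables (beta L Lbar sigma M D alpha : R) (K : R -> R)
  (Theta : set 'rV[R]_d) (f : 'I_n -> 'rV[R]_d -> R) (W : 'M[R]_n)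
  (r : 'I_n -> nat -> {RV P >-> R}) (xi xi' : 'I_n -> nat -> 'I_d -> {RV P >-> R})
  (x1 : 'rV[R]_d) (x : 'I_n -> nat -> Omega -> 'rV[R]_d) (xs : 'rV[R]_d).
Local Notation fbar := (average_fun f).
Local Notation rho := (spectral_norm (W - n%:R^-1 *: const_mx 1)).
Local Notation eta := (fun t : nat => 2 / (alpha * t%:R) : R).
Local Notation h := (fun t : nat => t%:R `^ (- (2 * beta)^-1) : R).
Local Notation U := (uniform_prob (@ltrN11 R)).
Hypotheses (hbeta : 2 <= beta) (hK : kernel_cond beta K).
Hypotheses (n0 : (1 <= n)%N) (d0 : (1 <= d)%N) (alpha0 : 0 < alpha).
Hypotheses (Theta0 : Theta !=set0) (cTheta : compact Theta)
  (cvTheta : convex_set (Theta : set (convex_lmodType 'rV[R]_d))).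
Hypotheses (fH : forall i, holder_class beta L (f i))
  (sf : forall i, smooth2 Lbar (f i)) (cF : strongly_convex alpha fbar).
Hypotheses (WS : doubly_stochastic W) (rho1 : rho < 1).
Hypothesis zo : zo_iterates Theta W f K eta h
  (fun i t => r i t) (fun i t j => xi i t j) (fun i t j => xi' i t j) x1 x.
Hypothesis noise : noise_cond sigma r xi xi' x.
Hypotheses (Txs : Theta xs) (xsmin : forall y, Theta y -> fbar xs <= fbar y).
Hypotheses (TD : ediam Theta <= D) (x1D : enorm (x1 - xs) <= D)
  (fM : forall k y, enorm (y - xs) <= D -> enorm (grad (f k) y) <= M).

(** In this and the next three constants [alpha], [d], [n], [T] and the spectral norm do not occur;
    [expected_regret] displays those factors separately. *)
Definition variance_const : R :=
  (\int[U]_u kernel0 K u ^+ 2) * (3 * ((M + Lbar) ^+ 2 + sigma ^+ 2)).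

Definition bias_const : R :=
  2 * (L * \int[U]_u (`|u| `^ beta * `|kernel0 K u|)) ^+ 2.

(** The factor [4 * (c1 + c3)] of [sum_gap_le]. *)
Definition consensus_const : R :=
  4 * ((1 + M * D * Lbar) + (Lbar * D + M + Lbar * D)).

(** The factor [beta] comes from [sum_powR_le]. *)
Definition regret_const : R :=
  (4 * bias_const + consensus_const * (1 + variance_const)) * beta.

Let b0 : 0 < beta. Proof. by apply: lt_le_trans hbeta. Qed.
Let sF : smooth2 Lbar fbar. Proof. exact: smooth2_average. Qed.
Let L0 : 0 <= Lbar.
Proof. by apply: le_trans (strongly_convex_smooth_le d0 cF sF); exact: ltW. Qed.
Let i0 : 'I_n := Ordinal n0.
Let D0 : 0 <= D. Proof. exact: le_trans (enorm_ge0 _) x1D. Qed.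
Let M0 : 0 <= M. Proof. exact: le_trans (enorm_ge0 _) (fM i0 x1D). Qed.

Lemma variance_const_ge0 : 0 <= variance_const.
Proof.
rewrite mulr_ge0//; first by apply: Rintegral_ge0 => u _; exact: sqr_ge0.
by rewrite mulr_ge0// addr_ge0 ?sqr_ge0.
Qed.

Lemma bias_const_ge0 : 0 <= bias_const.
Proof. by rewrite mulr_ge0// sqr_ge0. Qed.

Lemma consensus_const_ge0 : 0 <= consensus_const.
Proof. by rewrite mulr_ge0// !addr_ge0// !mulr_ge0. Qed.

Let cf k : continuous (f k).
Proof. by move=> y; apply: differentiable_continuous; have [] := sf k. Qed.

Lemma measurable_iterate t k j : (1 <= t)%N -> measurable_fun setT (fun w => x k t w 0 j).
Proof.
move=> t1.
by apply: (measurable_iterates Theta0 cTheta cvTheta zo (measurable_kernel0 hK) cf).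
Qed.

Lemma iterate_bounded t k w : (1 <= t)%N -> enorm (x k t w - xs) <= D.
Proof.
by move=> t1; apply: (iterates_bounded Theta0 cTheta zo w n0 WS Txs TD x1D).
Qed.

(** The choice of [h] balances the errors: the variance [h ^ (-2)] times the step [1 / t], and the
    squared bias [h ^ (2 (beta - 1))], both equal [t ^ (1 / beta - 1)]. *)
Let hsq t : (1 <= t)%N -> (h t ^+ 2)^-1 = t%:R `^ beta^-1.
Proof.
move=> t1; rewrite -powR_mulrn ?powR_ge0// -powRrM -powRN; congr (_ `^ _).
by field; rewrite gt_eqF.
Qed.

Let hbias t : (1 <= t)%N -> (h t `^ (beta - 1)) ^+ 2 = t%:R `^ (beta^-1 - 1).
Proof.
move=> t1; rewrite -powR_mulrn ?powR_ge0// -!powRrM; congr (_ `^ _).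
by field; rewrite gt_eqF.
Qed.

Let h01 t : (1 <= t)%N -> 0 < h t <= 1.
Proof.
move=> t1; rewrite powR_gt0 ?ltr0n//= -[leRHS](powRr0 (t%:R : R)).
by rewrite ler_powR ?ler1n// oppr_le0 invr_ge0 mulr_ge0// ltW.
Qed.

Let g k t w : 'rV[R]_d := grad_estimator K (h t) (f k) (x k t w) (r k t w)
  (fun j => xi k t j w) (fun j => xi' k t j w).

Let estimator t k j : (1 <= t)%N ->
  expect_le P (fun w => g k t w 0 j ^+ 2) (variance_const * t%:R `^ beta^-1) /\
  expect_le P (fun w => (2^-1 * partial j (f k) (x k t w) - g k t w 0 j) *
      (x k t w 0 j - xs 0 j) - alpha / 8 * (x k t w 0 j - xs 0 j) ^+ 2)
    (bias_const / alpha * t%:R `^ (beta^-1 - 1)).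
Proof.
move=> t1; have [rU indep xi2 xi'2] := noise k t1.
set S : set (Omega -> R) := [set X : Omega -> R | _] in indep.
have mS X : S X -> measurable_fun setT X.
  move=> [[j' ->]|[j' ->]|[k' [j' ->]]] //.
  exact: measurable_iterate.
have yM w : enorm (grad (f k) (x k t w)) <= M by apply: fM; exact: iterate_bounded.
have yD w : enorm (x k t w - xs) <= D by exact: iterate_bounded.
have Sy i : S (fun w => x k t w 0 i) by apply: Or33; exists k, i.
have Sxi : S (xi k t j) by apply: Or31; exists j.
have Sxi' : S (xi' k t j) by apply: Or32; exists j.
split; rewrite /expect_le.
  rewrite -hsq//.
  exact: (second_moment_grad_estimator hK L0 (h01 t1) (sf k) yM mS Sy Sxi Sxi' rU indep (xi2 j) (xi'2 j)).
rewrite -hbias//.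
have [I1 I2] := bias_grad_estimator hbeta hK L0 alpha0 (h01 t1) (fH k) (sf k) yM yD mS Sy Sxi Sxi' rU indep (xi2 j) (xi'2 j).
split; first exact: I1.
apply: (le_trans I2); rewrite le_eqVlt; apply/orP; left; apply/eqP.
by rewrite /bias_const !exprMn; ring.
Qed.

(** [H] is the right side of [sum_gap_le], a combination with nonnegative coefficients of variables
    already estimated, so its mean is bounded term by term. *)
Lemma expected_regret (T : nat) : exists2 H : Omega -> R,
  forall w, \sum_(1 <= t < T.+1) (fbar (average_iterate x t w) - fbar xs) <= H w &
  expect_le P H (regret_const * (d%:R / (alpha * (1 - rho))) * T%:R `^ beta^-1).
Proof.
have rho0 : 0 < 1 - rho by rewrite subr_gt0.
have rho_ge0 := spectral_norm_ge0 (W - n%:R^-1 *: const_mx 1).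
have nV0 : 0 <= (n%:R : R)^-1 by rewrite invr_ge0.
have q0 := consensus_const_ge0; have v0 := variance_const_ge0.
have bc0 := bias_const_ge0.
pose Q := consensus_const / (alpha * (1 - rho)).
have Q0 : 0 <= Q by rewrite divr_ge0// mulr_ge0// ltW.
pose H w := \sum_(i < T)
  (4 * (n%:R^-1 * \sum_k \sum_j
    ((2^-1 * partial j (f k) (x k i.+1 w) - g k i.+1 w 0 j) *
      (x k i.+1 w 0 j - xs 0 j) - alpha / 8 * (x k i.+1 w 0 j - xs 0 j) ^+ 2)) +
   Q * (i.+1%:R^-1 * (1 + n%:R^-1 * \sum_k \sum_j g k i.+1 w 0 j ^+ 2))).
exists H => [w|].
  have [xinit xstep] := zo.
  have := @sum_gap_le _ _ _ Theta W f (fun k t => g k t w) (fun k t => x k t w)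
    x1 xs alpha Lbar D M n0 d0 alpha0 Theta0 cTheta cvTheta sf cF WS rho1 Txs xsmin
    (fun k => xinit k w) (fun k t => xstep k t w)
    (fun k t => @iterate_bounded t k w) (fun k t t1 => fM k (iterate_bounded k w t1))
    (fun k => fM k _) T.
  move/(_ _)/le_trans; apply; first by rewrite subrr enorm0.
  rewrite big_add1 big_mkord le_eqVlt; apply/orP; left; apply/eqP.
  apply: eq_bigr => i _; rewrite /= -/Q; congr (_ + _ * _).
  rewrite mulrC; congr (_ * (1 + _ * _)); apply: eq_bigr => k _.
  by rewrite (sqr_l2norm (fun j => g k i.+1 w 0 j)).
pose c (i : nat) := 4 * (n%:R^-1 * \sum_(k < n) \sum_(j < d)
    (bias_const / alpha * i.+1%:R `^ (beta^-1 - 1))) +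
   Q * (i.+1%:R^-1 * (1 + n%:R^-1 * \sum_(k < n) \sum_(j < d)
    (variance_const * i.+1%:R `^ beta^-1))).
have [IH HC] : expect_le P H (\sum_(i < T) c i).
  apply: expect_le_sum => i; apply: expect_leD.
    apply: expect_leZ => //; apply: expect_leZ => //.
    apply: expect_le_sum => k; apply: expect_le_sum => j.
    by have [] := estimator k j (ltn0Sn i).
  apply: expect_leZ => //; apply: expect_leZ; first by rewrite invr_ge0.
  apply: expect_leD; first exact: expect_le_cst.
  apply: expect_leZ => //.
  apply: expect_le_sum => k; apply: expect_le_sum => j.
  by have [] := estimator k j (ltn0Sn i).
split=> //; apply: (le_trans HC).
pose E := (4 * bias_const + consensus_const * (1 + variance_const)) *
  (d%:R / (alpha * (1 - rho))).
have E0 : 0 <= E.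
  apply: mulr_ge0; last by apply: divr_ge0 => //; apply: mulr_ge0; exact: ltW.
  by apply: addr_ge0; apply: mulr_ge0 => //; exact: addr_ge0.
have cE i : c i <= E * i.+1%:R `^ (beta^-1 - 1).
  have cc (X : R) : \sum_(k < n) \sum_(j < d) X = n%:R * (d%:R * X).
    by rewrite !sumr_const !card_ord [RHS]mulr_natl [d%:R * X]mulr_natl.
  rewrite /c !cc.
  set t : R := i.+1%:R; set p := t `^ (beta^-1 - 1).
  have t0 : 0 < t by [].
  have n0' : n%:R != 0 :> R by rewrite pnatr_eq0 -lt0n.
  have tE : t `^ beta^-1 = t * p.
    have := @powRD R t 1 (beta^-1 - 1).
    by rewrite addrCA subrr addr0 powRr1 ?(ltW t0)// [t == 0]gt_eqF//= implybT; exact.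
  have p0 : 0 <= p by exact: powR_ge0.
  (* The lone [1 / t] coming from [1 + q t] is absorbed, as [1 / t <= t ^ (1 / beta - 1)] and
     [d >= 1]. *)
  have tp : t^-1 <= d%:R * p.
    have tp1 : t^-1 <= p.
      have -> : t^-1 = t `^ (- 1) by rewrite powRN powRr1// ltW.
      by rewrite ler_powR ?ler1n// lerBrDl addrN invr_ge0 ltW.
    by rewrite (le_trans tp1)// ler_peMl// ler1n.
  rewrite tE !mulKf//.
  have -> : t^-1 * (1 + d%:R * (variance_const * (t * p))) =
      t^-1 + variance_const * (d%:R * p).
    by field; rewrite gt_eqF.
  (* As the spectral norm is nonnegative, the bias may be charged the consensus factor too. *)
  have e1 : alpha^-1 <= (alpha * (1 - rho))^-1.
    rewrite lef_pV2 ?posrE ?mulr_gt0// ler_piMr ?(ltW alpha0)//.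
    by rewrite gerBl.
  have e2 : 4 * (d%:R * (bias_const / alpha * p)) <=
      4 * bias_const * (d%:R / (alpha * (1 - rho))) * p.
    rewrite (_ : 4 * (d%:R * (bias_const / alpha * p)) =
      (4 * bias_const * d%:R * p) * alpha^-1); last by ring.
    rewrite (_ : 4 * bias_const * (d%:R / (alpha * (1 - rho))) * p =
      (4 * bias_const * d%:R * p) * (alpha * (1 - rho))^-1); last by ring.
    apply: ler_wpM2l => //; apply: mulr_ge0 => //; apply: mulr_ge0 => //.
    exact: mulr_ge0.
  have e3 : Q * (t^-1 + variance_const * (d%:R * p)) <=
      consensus_const * (1 + variance_const) * (d%:R / (alpha * (1 - rho))) * p.
    rewrite (_ : consensus_const * (1 + variance_const) * _ * p =
      Q * (d%:R * p + variance_const * (d%:R * p))); last by rewrite /Q; ring.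
    by apply: ler_wpM2l => //; rewrite lerD2r.
  apply: le_trans (lerD e2 e3) _.
  by rewrite /E le_eqVlt; apply/orP; left; apply/eqP; ring.
apply: (@le_trans _ _ (\sum_(i < T) E * i.+1%:R `^ (beta^-1 - 1))).
  by apply: ler_sum => i _; exact: cE.
rewrite -mulr_sumr -(big_mkord xpredT (fun i => (i.+1%:R : R) `^ (beta^-1 - 1))).
rewrite -(big_add1 _ _ 0 T.+1 xpredT (fun t => t%:R `^ (beta^-1 - 1))).
have := sum_powR_le T (lt_le_trans (ltr1n R 2) hbeta).
move/(ler_wpM2l E0)/le_trans; apply.
by rewrite /E /regret_const le_eqVlt; apply/orP; left; apply/eqP; ring.
Qed.

End expected_regret.

(* [T0] steps of [2 * d] queries each: [d * T0 ^ (s - 1)] in terms of the budget. *)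
Lemma budget_rate {R : realType} (beta : R) (d T0 : nat) : 1 < beta ->
  (0 < d)%N -> (0 < T0)%N ->
  T0%:R^-1 * (d%:R * T0%:R `^ beta^-1) <=
  2 * (d%:R `^ (2 - beta^-1) * (T0 * (2 * d))%:R `^ (- ((beta - 1) / beta))).
Proof.
move=> b1 d0 T00; have b0 : 0 < beta by apply: lt_trans b1.
have -> : - ((beta - 1) / beta) = beta^-1 - 1 by field; rewrite gt_eqF.
rewrite !natrM; set t : R := T0%:R; set e : R := d%:R; set s := beta^-1.
have t0 : 0 < t by rewrite ltr0n.
have e0 : 0 < e by rewrite ltr0n.
have s0 : 0 < s by rewrite invr_gt0.
rewrite !powRM ?mulr_ge0 ?(ltW t0) ?(ltW e0)//.
have pB (a : R) : 0 < a -> a `^ s = a * a `^ (s - 1).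
  move=> a0; have := @powRD R a 1 (s - 1).
  by rewrite addrCA subrr addr0 powRr1 ?(ltW a0)// [a == 0]gt_eqF//= implybT; exact.
have ee : e `^ (2 - s) * e `^ (s - 1) = e.
  rewrite -powRD ?[e == 0]gt_eqF ?implybT//.
  by rewrite (_ : 2 - s + (s - 1) = 1) ?powRr1 ?(ltW e0)//; ring.
rewrite pB// mulrCA mulKf ?gt_eqF//.
rewrite (_ : 2 * _ = (2 `^ s) * (e * t `^ (s - 1))).
  rewrite ler_peMl ?mulr_ge0 ?powR_ge0 ?(ltW e0)//.
  by rewrite -[leLHS](powRr0 (2 : R)) ler_powR ?ler1n// ltW.
by rewrite (pB 2)// -[in RHS]ee; ring.
Qed.

(** * Both branches of the minimum *)

Unset Implicit Arguments.

Theorem corollary6 (R : realType) (beta L Lbar sigma G calK : R) (K : R -> R)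
    (hbeta : 2 <= beta) (hL : 0 < L) (hLbar : 0 < Lbar) (hsigma : 0 <= sigma)
    (hG : 0 < G) (hcalK : 0 < calK) (hK : kernel_cond beta K) :
  exists C : R -> R -> R, (forall a b, 0 < C a b) /\
  forall (n d : nat) (alpha : R) (T : nat)
    (Theta : set 'rV[R]_d) (f : 'I_n -> 'rV[R]_d -> R) (W : 'M[R]_n)
    (dO : measure_display) (Omega : measurableType dO)
    (P : probability Omega R)
    (r : 'I_n -> nat -> {RV P >-> R})
    (xi xi' : 'I_n -> nat -> 'I_d -> {RV P >-> R})
    (x1 : 'rV[R]_d) (x : 'I_n -> nat -> Omega -> 'rV[R]_d) (xstar : 'rV[R]_d),
  let fbar := average_fun f in
  let rho := spectral_norm (W - n%:R^-1 *: const_mx 1) in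
  let eta := fun t : nat => 2 / (alpha * t%:R) in
  let h := fun t : nat => t%:R `^ (- (2 * beta)^-1) in
  (1 <= n)%N -> (1 <= d)%N -> 0 < alpha ->
  (2 * d <= T)%N -> (2 * d %| T)%N ->
  Theta !=set0 -> convex_set (Theta : set (convex_lmodType 'rV[R]_d)) ->
  compact Theta -> ediam Theta <= calK ->
  (forall i, holder_class beta L (f i)) ->
  (forall i, smooth2 Lbar (f i)) ->
  strongly_convex alpha fbar ->
  (forall y, Theta y -> enorm (grad fbar y) <= G) ->
  W^T = W -> doubly_stochastic W -> rho < 1 ->
  zo_iterates Theta W f K eta h
    (fun i t => r i t) (fun i t j => xi i t j) (fun i t j => xi' i t j) x1 x ->
  noise_cond sigma r xi xi' x ->
  Theta xstar -> (forall y, Theta y -> fbar xstar <= fbar y) ->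
  ('E_P[fun w => (fbar (time_average x (T %/ (2 * d)) w) - fbar xstar)%R]
    <= (C (max_grad f Theta) (edist_set x1 Theta) *
        Num.min 1 (d%:R `^ (2 - beta^-1) / (alpha * (1 - rho))
                   * T%:R `^ (- ((beta - 1) / beta))))%:E)%E.
Proof.
(* [D] covers the diameter and the distance from [x1] to the minimizer; [M] bounds each agent's
   gradient within [D] of the minimizer. Absolute values keep both nonnegative for all arguments. *)
pose D (b : R) := calK + `|b|; pose M (a b : R) : R := `|a| + Lbar * D b.
pose C1 a b := regret_const beta L Lbar sigma (M a b) (D b) K.
pose C2 a b := (M a b + Lbar * D b) * D b.
(* The 2 is that of [budget_rate], the second term serves the bounded branch, and the 1 ensures
   positivity. *)
exists (fun a b => 2 * `|C1 a b| + `|C2 a b| + 1); split=> [a b|].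
  by rewrite ltr_wpDl// addr_ge0// mulr_ge0.
move=> n d alpha T Theta f W dO Omega P r xi xi' x1 x xs fbar rho eta h n0 d0.
move=> alpha0 dT dvdT Theta0 cvTheta cTheta diamTheta fH sf cF _ _ WS rho1 zo.
move=> noise Txs xsmin.
set a := max_grad f Theta; set b := edist_set x1 Theta; set T0 := (T %/ (2 * d))%N.
have TE : T = (T0 * (2 * d))%N by rewrite divnK.
have T00 : (0 < T0)%N by rewrite divn_gt0// muln_gt0.
have rho0 : 0 < 1 - rho by rewrite subr_gt0.
have TD : ediam Theta <= D b by rewrite (le_trans diamTheta)// lerDl.
have x1D : enorm (x1 - xs) <= D b.
  rewrite (le_trans (enorm_le_edist_set x1 cTheta Txs))// lerD//.
  exact: ler_norm.
have fM k y : enorm (y - xs) <= D b -> enorm (grad (f k) y) <= M a b.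
  move=> yD; rewrite -(subrK (grad (f k) xs) (grad (f k) y)).
  rewrite (le_trans (ler_enormD _ _))// addrC lerD//.
    rewrite (le_trans (grad_le_max_grad k cTheta sf Txs))//.
    exact: ler_norm.
  have [_ /(_ y xs)/le_trans] := sf k; apply.
  by rewrite ler_wpM2l// ltW.
have [H SH HC] := expected_regret hbeta hK n0 d0 alpha0 Theta0 cTheta cvTheta
  fH sf cF WS rho1 zo noise Txs xsmin TD x1D fM T0.
have sF : smooth2 Lbar fbar by exact: smooth2_average.
pose Z w := fbar (time_average x T0 w) - fbar xs.
have T0R : 0 < T0%:R :> R by rewrite ltr0n.
have mx t k j : (1 <= t)%N -> measurable_fun setT (fun w => x k t w 0 j).
  by move=> t1; exact: (measurable_iterate hK Theta0 cTheta cvTheta sf zo).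
have xD k t w : (1 <= t)%N -> enorm (x k t w - xs) <= D b.
  by move=> t1; exact: (iterate_bounded n0 Theta0 cTheta WS zo Txs TD x1D).
have mZ : measurable_fun setT Z.
  pose X j w := T0%:R^-1 * \sum_(t < T0) (n%:R^-1 * \sum_k x k t.+1 w 0 j).
  have -> : Z = fun w => fbar (\row_j X j w) - fbar xs.
    apply/funext => w; congr (fbar _ - _); apply/rowP => j.
    rewrite !mxE summxE big_add1 big_mkord; congr (_ * _).
    by apply: eq_bigr => t _; rewrite !mxE summxE.
  apply: measurable_funB => //; apply: measurable_continuous_rV => [y|j].
    by apply: differentiable_continuous; have [] := sF.
  apply: measurable_funM => //; apply: measurable_sum => t.
  by apply: measurable_funM => //; apply: measurable_sum => k; exact: mx.
have ZB w : `|Z w| <= C2 a b.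
  have fxs k : enorm (grad (f k) xs) <= M a b.
    by apply: fM; rewrite subrr enorm0 addr_ge0// ltW.
  exact: (gap_time_average_bounded n0 d0 alpha0 sf cF (fun k t => @xD k t w) fxs T00).
have ZH w : Z w <= T0%:R^-1 * H w.
  rewrite ler_pdivlMl// (le_trans _ (SH w))//.
  exact: (gap_time_average_le (fun k t => x k t w) xs alpha0 cF T00).
have T0V : 0 <= T0%:R^-1 :> R by rewrite invr_ge0 ltW.
have E1 : ('E_P[Z] <= (C2 a b)%:E)%E.
  apply: (expectation_le_bounded mZ ZB _ (expect_le_cst P (C2 a b))) => w.
  exact: le_trans (ler_norm _) (ZB w).
have E2 := expectation_le_bounded mZ ZB ZH (expect_leZ T0V HC).
set X := _ * T%:R `^ _.
have X0 : 0 <= X.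
  by rewrite mulr_ge0 ?powR_ge0// divr_ge0 ?powR_ge0// mulr_ge0// ltW.
have C10 : C1 a b <= `|C1 a b| by exact: ler_norm.
have E3 : ('E_P[Z] <= (2 * `|C1 a b| * X)%:E)%E.
  apply: (le_trans E2); rewrite lee_fin -/(C1 a b) -/rho.
  have := budget_rate (lt_le_trans (ltr1n R 2) hbeta) d0 T00; rewrite -TE => rate.
  have k0 : 0 <= `|C1 a b| / (alpha * (1 - rho)).
    by rewrite divr_ge0// mulr_ge0// ltW.
  have := ler_wpM2l k0 rate.
  rewrite [leRHS](_ : _ = 2 * `|C1 a b| * X); last by rewrite /X; ring.
  apply: le_trans.
  rewrite [leLHS](_ : _ = C1 a b * ((alpha * (1 - rho))^-1 *
    (T0%:R^-1 * (d%:R * T0%:R `^ beta^-1)))); last by ring.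
  rewrite -[leRHS]mulrA ler_wpM2r//.
  by rewrite !mulr_ge0 ?powR_ge0// invr_ge0 mulr_ge0// ltW.
have [X1|X1] := leP 1 X.
  rewrite mulr1; apply: (le_trans E1); rewrite lee_fin.
  by rewrite (le_trans (ler_norm _))// -addrA addrCA lerDl addr_ge0// mulr_ge0.
apply: (le_trans E3); rewrite lee_fin ler_wpM2r//.
by rewrite -addrA lerDl addr_ge0.
Qed.
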